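(* (Comparison theorem) Let $b_1,b_2,\sigma_1,\sigma_2:[0,T]\times\mathbb{R}\to\mathbb{R}$ be continuous functions such that, for $i=1,2$, the pair $(b,\sigma)=(b_i,\sigma_i)$ satisfies the assumptions $(H_1)$ and $(H_2)$ stated in the context (with common exponents $\beta,\delta,\mu$), where $\beta>1-H$ and $\delta>\frac1H-1$. For $t\in[0,T]$ and $x,y\in\mathbb{R}$ let $X^{t,x}$, $Y^{t,y}$ be the solutions of the decoupled system $$X_s^{t,x}=x+\int_t^s b_1(r,X_r^{t,x})dr+\int_t^s\sigma_1(r,X_r^{t,x})dB^H_r,\quad s\in[t,T],$$ $$Y_s^{t,y}=y+\int_t^s b_2(r,Y_r^{t,y})dr+\int_t^s\sigma_2(r,Y_r^{t,y})dB^H_r,\quad s\in[t,T].$$ Then the following are equivalent: (a) for any $t\in[0,T]$ and every $x\le y$, almost surely $X_s^{t,x}\le Y_s^{t,y}$ for all $s\in[t,T]$; (b) $b_1(t,z)\le b_2(t,z)$ and $\sigma_1(t,z)=\sigma_2(t,z)$ for all $t\in[0,T]$ and all $z\in\mathbb{R}$.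
   Context: Fix $T>0$, $H\in(\frac12,1)$ and a real-valued fractional Brownian motion $B^H=\{B^H_t,t\ge 0\}$ with Hurst parameter $H$ on a complete probability space $(\Omega,\mathcal F,\mathbb P)$. Integrals with respect to $B^H$ are pathwise Riemann-Stieltjes (Young) integrals. $(H_1)$ (for $\sigma:[0,T]\times\mathbb{R}\to\mathbb{R}$): $\sigma(t,x)$ is differentiable in $x$, and there are constants $\beta,\delta\in(0,1]$, $M_0>0$, and for every $\rho>0$ a constant $M_\rho>0$, such that for all $s,t\in[0,T]$: (i) $|\sigma(t,x)-\sigma(s,y)|\le M_0(|t-s|^\beta+|x-y|)$ for all $x,y\in\mathbb{R}$; (ii) $|\partial_x\sigma(t,y)-\partial_x\sigma(s,z)|\le M_\rho(|t-s|^\beta+|y-z|^\delta)$ for all $|y|,|z|\le \rho$. Set $\alpha_0=\min\{\frac12,\beta,\frac{\delta}{1+\delta}\}$. $(H_2)$ (for $b:[0,T]\times\mathbb{R}\to\mathbb{R}$): there are $\mu\in(1-\alpha_0,1]$, $L_0>0$, and for every $\rho\ge0$ a constant $L_\rho>0$, such that for all $s,t\in[0,T]$: (i) $|b(t,x)-b(s,y)|\le L_\rho(|t-s|^\mu+|x-y|)$ for all $|x|,|y|\le\rho$; (ii) $|b(t,x)|\le L_0(1+|x|)$ for all $x\in\mathbb{R}$. Under these assumptions each equation has a unique solution with trajectories a.s. in the space $W^{\alpha,\infty}(t,T;\mathbb{R})$, for all $\alpha\in(1-H,\alpha_0)$, and these trajectories are a.s. $(1-\alpha)$-Hölder continuous;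 this is the meaning of ''solution''. Here $W^{\alpha,\infty}(t,T;\mathbb{R})$ is the space of continuous $f:[t,T]\to\mathbb{R}$ with $\sup_{s\in[t,T]}\left(|f(s)|+\int_t^s\frac{|f(s)-f(r)|}{(s-r)^{\alpha+1}}dr\right)<\infty$. *)

(* Defs.v *)
From HB Require Import structures.
From mathcomp Require Import all_boot all_order all_algebra.
From mathcomp Require Import all_classical all_reals all_analysis.
Set Implicit Arguments.
Unset Strict Implicit.
Unset Printing Implicit Defensive.
Import Order.TTheory GRing.Theory Num.Theory.
Import numFieldNormedType.Exports.
Local Open Scope classical_set_scope.
Local Open Scope ring_scope.

Section paths.
Context {R : realType}.

(* [s] lists the partition points after [a], the last one being [b];
   [tags] picks one evaluation point in each cell. *)
Definition RS_sum (f g : R -> R) (a b : R) (s tags : seq R) : R :=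
  \sum_(i < size s)
    f (nth b tags i) * (g (nth b s i) - g (nth b (a :: s) i)).

Definition tagged_partition (a b : R) (s tags : seq R) : Prop :=
  [/\ itv_partition a b s, size tags = size s &
      forall i, (i < size s)%N ->
        nth b (a :: s) i <= nth b tags i <= nth b s i].

(* [int_a^b f dg] exists as a Riemann-Stieltjes integral and equals [l]:
   convergence of the tagged sums as the mesh tends to 0. *)
Definition is_RS_integral (f g : R -> R) (a b l : R) : Prop :=
  forall e : R, 0 < e -> exists2 d : R, 0 < d &
    forall s tags : seq R, tagged_partition a b s tags ->
      (forall i, (i < size s)%N -> nth b s i - nth b (a :: s) i < d) ->
      `|RS_sum f g a b s tags - l| < e.

Definition holder_on (t T gamma : R) (f : R -> R) : Prop :=
  exists C : R, forall r s : R, r \in `[t, T] -> s \in `[t, T] ->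
    `|f s - f r| <= C * `|s - r| `^ gamma.

Definition W_norm (alpha t T : R) (f : R -> R) : \bar R :=
  ereal_sup [set (`|f s|%:E +
    \int[lebesgue_measure]_(r in `[t, s[)
      (`|f s - f r| / (s - r) `^ (alpha + 1))%:E)%E | s in `[t, T]].

Definition in_W (alpha t T : R) (f : R -> R) : Prop :=
  {within `[t, T], continuous f} /\ (W_norm alpha t T f < +oo)%E.

End paths.

Section assumptions.
Context {R : realType}.

Definition alpha0 (beta delta : R) : R :=
  Num.min (2^-1) (Num.min beta (delta / (1 + delta))).

Definition hyp_H1 (T beta delta : R) (sigma : R -> R -> R) : Prop :=
  [/\ 0 < beta <= 1, 0 < delta <= 1,
      forall t x : R, t \in `[0, T] -> derivable (sigma t) x 1,
      exists2 M0 : R, 0 < M0 &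
        forall s t x y : R, s \in `[0, T] -> t \in `[0, T] ->
          `|sigma t x - sigma s y| <= M0 * (`|t - s| `^ beta + `|x - y|)
    & forall rho : R, 0 < rho -> exists2 M : R, 0 < M &
        forall s t y z : R, s \in `[0, T] -> t \in `[0, T] ->
          `|y| <= rho -> `|z| <= rho ->
          `|derive1 (sigma t) y - derive1 (sigma s) z|
            <= M * (`|t - s| `^ beta + `|y - z| `^ delta)].

Definition hyp_H2 (T beta delta mu : R) (b : R -> R -> R) : Prop :=
  [/\ 1 - alpha0 beta delta < mu <= 1,
      forall rho : R, 0 <= rho -> exists2 L : R, 0 < L &
        forall s t x y : R, s \in `[0, T] -> t \in `[0, T] ->
          `|x| <= rho -> `|y| <= rho ->
          `|b t x - b s y| <= L * (`|t - s| `^ mu + `|x - y|)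
    & exists2 L0 : R, 0 < L0 &
        forall t x : R, t \in `[0, T] -> `|b t x| <= L0 * (1 + `|x|)].

Definition continuous_strip (T : R) (f : R -> R -> R) : Prop :=
  {within `[0, T] `*` [set: R], continuous (fun p : R * R => f p.1 p.2)}.

End assumptions.

Section processes.
Context {d : measure_display} {Omega : measurableType d} {R : realType}.
Variable P : probability Omega R.

(* The degenerate case is separate because [normal_prob m 0] is by convention
   the uniform law on [0, 1], not the Dirac mass at [m]. *)
Definition gaussian (Z : Omega -> R) : Prop :=
  measurable_fun setT Z /\
  ((exists m : R, forall A : set R, measurable A ->
      P (Z @^-1` A) = \d_m A) \/
   (exists m s : R, 0 < s /\ forall A : set R, measurable A ->
      P (Z @^-1` A) = normal_prob m s A)).

Definition gaussian_process (B : R -> Omega -> R) : Prop :=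
  forall (n : nat) (t a : 'I_n -> R), (forall i, 0 <= t i) ->
    gaussian (fun w => \sum_(i < n) a i * B (t i) w).

(* Only the values [B t] with [0 <= t] matter; [B 0 = 0] almost surely follows
   from the mean and covariance. *)
Definition fBm (H : R) (B : R -> Omega -> R) : Prop :=
  [/\ gaussian_process B,
      forall t : R, 0 <= t -> ('E_P[B t] = 0)%E,
      forall s t : R, 0 <= s -> 0 <= t -> covariance P (B s) (B t) =
        ((s `^ (2 * H) + t `^ (2 * H) - `|t - s| `^ (2 * H)) / 2)%:E
    & \forall w \ae P, {within `[0, +oo[, continuous (fun t => B t w)}].

(* [X s w] is the value at time [s] of the solution started from [x] at time
   [t]; its values for [s] outside [t, T] are irrelevant. *)
Definition is_solution (H T beta delta : R) (B : R -> Omega -> R)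
    (b sigma : R -> R -> R) (t x : R) (X : R -> Omega -> R) : Prop :=
  [/\ forall s : R, s \in `[t, T] -> measurable_fun setT (X s),
      forall alpha : R, 1 - H < alpha < alpha0 beta delta ->
        \forall w \ae P, in_W alpha t T (X ^~ w) /\
                         holder_on t T (1 - alpha) (X ^~ w)
    & \forall w \ae P, forall s : R, s \in `[t, T] ->
        exists2 I : R,
          is_RS_integral (fun r => sigma r (X r w)) (B ^~ w) t s I
        & X s w = x + \int[lebesgue_measure]_(r in `[t, s]) b r (X r w) + I].

End processes.

(* Main.v *)
(* Along the dyadic grid of [t, T] with mesh h, Young's estimate turns the
   equations into X_{i+1} - X_i = b(t_i, X_i) h + sigma(t_i, X_i) dB_i + O(h^e)
   with e > 1, because the paths of B and of the solutions are Holder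
   continuous of every order below H, respectively of some order 1 - alpha.

   Sufficiency. Z = Y - X satisfies
   Z_{i+1} >= (1 + theta_i dB_i) Z_i - L h |Z_i| - O(h^e), where theta is the
   divided difference of sigma between X and Y, again Holder continuous. Young's
   estimate bounds the sums of theta_i dB_i uniformly in h, so a discrete
   Gronwall argument bounds the negative part of Z by O(h^(e-1)), which tends to
   0.

   Necessity. Started from the same point z at time t, the first grid step gives
   0 <= (b2 - b1)(t, z) h + (sigma2 - sigma1)(t, z) (B_{t+h} - B_t) + O(h^e).
   The increment of B has order h^H, much larger than h, and either sign with
   probability bounded below, infinitely often with positive probability;
   hence sigma1 = sigma2 at (t, z), and dividing by h gives b1 <= b2.

   The Holder continuity of the paths of B on the grid is Kolmogorov's criterion,
   from Gaussian tails and the Borel-Cantelli lemma. *)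
Require Import Defs.
From mathcomp Require Import all_boot all_order all_algebra.
From mathcomp Require Import all_classical all_reals all_analysis.
From mathcomp Require Import measurable_realfun.
From mathcomp Require Import zify ring lra.
Set Implicit Arguments.
Unset Strict Implicit.
Unset Printing Implicit Defensive.
Import Order.TTheory GRing.Theory Num.Theory.
Import numFieldNormedType.Exports.
Local Open Scope classical_set_scope.
Local Open Scope ring_scope.

(** * Young's estimate on dyadic grids *)

(** Since [x ^ p = x ^ (p - q) * x ^ q], a higher exponent can be traded for a lower one on a
    bounded range. This is how errors of several orders are brought to the smallest of them. *)
Lemma ler_powR_base (R : realType) (x L p q : R) :
  0 <= x <= L -> 0 < q <= p -> x `^ p <= L `^ (p - q) * x `^ q.
Proof.
move=> /andP[x0 xL] /andP[q0 qp].
have [->|xn0] := eqVneq x 0.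
  by rewrite !powR0 ?mulr0// gt_eqF// (lt_le_trans q0).
rewrite -[in leLHS](subrK q p) (@powRD _ x) ?xn0 ?implybT//.
by rewrite ler_wpM2r ?powR_ge0// ge0_ler_powR ?nnegrE ?subr_ge0// (le_trans x0).
Qed.

Lemma ltr_powR_root (R : realType) (x e p : R) :
  0 <= x -> 0 < e -> 0 < p -> x < e `^ p^-1 -> x `^ p < e.
Proof.
move=> x0 e0 p0 xe.
rewrite -[ltRHS](powRr1 (ltW e0)) -(mulVf (lt0r_neq0 p0)) powRrM.
by rewrite gt0_ltr_powR ?nnegrE ?powR_ge0.
Qed.

(** The fixed point of [K = 2 * K * 2 ^ (- c) + 2], the recursion for the constant when a block is
    halved. For [c > 1] it is positive. *)
Definition young_const {R : realType} (c : R) : R := 2 / (1 - 2 `^ (1 - c)).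

Lemma young_const_gt0 (R : realType) (c : R) : 1 < c -> 0 < young_const c.
Proof.
move=> c1; rewrite divr_gt0// subr_gt0 /powR pnatr_eq0/= -[ltRHS]expR0 ltr_expR.
by rewrite pmulr_llt0 ?ln_gt0 ?ltr1n// subr_lt0.
Qed.

(** A block of [n.+1] cells loses its middle cell; [p] and [q] are the lengths of what remains on
    its left and right. *)
Lemma halving (n : nat) :
  exists p q : nat, [/\ n = (p + q)%N, (p.*2 <= n.+1)%N & (q.*2 <= n.+1)%N].
Proof. by exists n./2, (n - n./2)%N; split; lia. Qed.

(* Splitting off the middle cell leaves two blocks of at most half the length,
   and the factor [2 * 2^-(a+b)] < 1 makes the constant reproduce itself. *)
Lemma young_sum_le (R : realType) (F G : nat -> R) (N : nat) (a b A D : R) :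
  0 <= A -> 0 <= D -> 0 < a -> 0 < b -> 1 < a + b ->
  (forall i j, (i <= j <= N)%N -> `|F j - F i| <= A * (j - i)%:R `^ a) ->
  (forall i j, (i <= j <= N)%N -> `|G j - G i| <= D * (j - i)%:R `^ b) ->
  forall n j, (j + n <= N)%N ->
  `|\sum_(j <= i < j + n) F i * (G i.+1 - G i) - F j * (G (j + n)%N - G j)|
    <= young_const (a + b) * (A * D) * n%:R `^ (a + b).
Proof.
move=> A0 D0 a0 b0 ab1 HF HG n.
set c := a + b; set K := young_const c.
have c0 : 0 < c by rewrite (lt_trans ltr01).
have AD0 : 0 <= A * D by rewrite mulr_ge0.
have K0 : 0 < K by exact: young_const_gt0.
have Keq : 2 * K * 2^-1 `^ c + 2 = K.
  have q0 : 0 < 1 - 2 `^ (1 - c) :> R.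
    by have := K0; rewrite /K /young_const pmulr_rgt0 ?invr_gt0.
  have E : 2 * 2^-1 `^ c = 2 `^ (1 - c) :> R.
    rewrite (@powRD _ _ 1) ?pnatr_eq0 ?implybT// powRr1//.
    by rewrite -(powR_inv1 (ler0n _ 2)) -powRrM mulN1r powRN.
  rewrite (_ : 2 * K * _ = K * (2 * 2^-1 `^ c)); last by ring.
  by rewrite E /K /young_const; field; rewrite gt_eqF.
have [m le_nm] := ubnP n; elim: m => // m IHm in n le_nm *.
case: n => [|n] in le_nm * => j jN.
  by rewrite addn0 big_geq// subrr mulr0 subr0 normr0 powR0 ?mulr0 ?gt_eqF.
have [p [q [np p2 q2]]] := halving n.
have pq : (j + n.+1 = (j + p).+1 + q)%N by rewrite np addSn addnS addnA.
have pn : (p <= n)%N by rewrite np leq_addr.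
have qn : (q <= n)%N by rewrite np leq_addl.
have jpN : (j + p < N)%N by rewrite (leq_trans _ jN)// ltn_add2l ltnS.
have jpqN : ((j + p).+1 + q <= N)%N by rewrite -pq.
have Hp := IHm p (leq_ltn_trans pn le_nm) j (ltnW jpN).
have Hq := IHm q (leq_ltn_trans qn le_nm) (j + p).+1 jpqN.
have half r : (r.*2 <= n.+1)%N -> r%:R `^ c <= 2^-1 `^ c * n.+1%:R `^ c :> R.
  move=> rn; rewrite -powRM// ge0_ler_powR ?nnegrE ?mulr_ge0 ?(ltW c0)//.
  have : r.*2%:R <= n.+1%:R :> R by rewrite ler_nat.
  by rewrite -muln2 natrM; lra.
have wA r : (r <= n.+1)%N -> A * r%:R `^ a <= A * n.+1%:R `^ a.
  by move=> rn; rewrite ler_wpM2l// ge0_ler_powR ?nnegrE ?(ltW a0)// ler_nat.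
have wD r : (r <= n.+1)%N -> D * r%:R `^ b <= D * n.+1%:R `^ b.
  by move=> rn; rewrite ler_wpM2l// ge0_ler_powR ?nnegrE ?(ltW b0)// ler_nat.
have h1 : `|F (j + p)%N - F j| <= A * n.+1%:R `^ a.
  rewrite (le_trans (HF _ _ _)) ?leq_addr ?(ltnW jpN)// wA// addKn.
  exact: leqW.
have h2 : `|F (j + p).+1 - F j| <= A * n.+1%:R `^ a.
  by rewrite (le_trans (HF _ _ _)) ?leqW ?leq_addr//= wA// -addnS addKn.
have h3 : `|G (j + p).+1 - G (j + p)%N| <= D * n.+1%:R `^ b.
  by rewrite (le_trans (HG _ _ _)) ?leqnSn//= wD// subSnn.
have h4 : `|G ((j + p).+1 + q)%N - G (j + p).+1| <= D * n.+1%:R `^ b.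
  rewrite (le_trans (HG _ _ _)) ?leq_addr//= wD// addKn.
  exact: leqW.
rewrite pq (big_cat_nat (n := (j + p)%N)) ?leq_addr//=; last first.
  by rewrite ltnW// -addSn leq_addr.
rewrite (big_cat_nat (m := (j + p)%N) (n := (j + p).+1)) ?leq_addr//= big_nat1.
set S1 := \sum_(j <= i < j + p) _ in Hp *.
set S2 := \sum_((j + p).+1 <= i < _) _ in Hq *.
(* Re-basing the middle cell and the right block at [j] costs one product of increments each. These
   two products account for the [+ 2] in [Keq]. *)
rewrite (_ : _ - _ =
  (S1 - F j * (G (j + p)%N - G j)) +
  (S2 - F (j + p).+1 * (G ((j + p).+1 + q)%N - G (j + p).+1)) +
  ((F (j + p)%N - F j) * (G (j + p).+1 - G (j + p)%N) +
   (F (j + p).+1 - F j) * (G ((j + p).+1 + q)%N - G (j + p).+1))); last first.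
  by ring.
have cab : A * n.+1%:R `^ a * (D * n.+1%:R `^ b) = A * D * n.+1%:R `^ c.
  by rewrite /c powRD ?pnatr_eq0 ?implybT//; ring.
have e1 : `|(F (j + p)%N - F j) * (G (j + p).+1 - G (j + p)%N)|
    <= A * D * n.+1%:R `^ c by rewrite -cab normrM ler_pM.
have e2 : `|(F (j + p).+1 - F j) * (G ((j + p).+1 + q)%N - G (j + p).+1)|
    <= A * D * n.+1%:R `^ c by rewrite -cab normrM ler_pM.
have e3 := ler_wpM2l (mulr_ge0 (ltW K0) AD0) (half _ p2).
have e4 := ler_wpM2l (mulr_ge0 (ltW K0) AD0) (half _ q2).
have -> : K * (A * D) * n.+1%:R `^ c =
    K * (A * D) * (2^-1 `^ c * n.+1%:R `^ c) +
    K * (A * D) * (2^-1 `^ c * n.+1%:R `^ c) +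
    (A * D * n.+1%:R `^ c + A * D * n.+1%:R `^ c).
  by rewrite -[in LHS]Keq; ring.
rewrite (le_trans (ler_normD _ _))// lerD// (le_trans (ler_normD _ _))// lerD//.
  exact: le_trans Hp e3.
exact: le_trans Hq e4.
Qed.

(** * Dyadic grids of a time interval *)

Definition mesh {R : realType} (t T : R) (n : nat) : R := (T - t) / 2 ^+ n.

Definition dyadic {R : realType} (t T : R) (n i : nat) : R :=
  t + i%:R * mesh t T n.

(** Restricted to pairs of points of a common level: this is all that sums along the grid see, and
    for [B] it involves only countably many increments, as the Borel-Cantelli argument requires. *)
Definition holder_dyadic_on {R : realType} (t T gamma : R) (f : R -> R) : Prop :=
  exists2 C : R, 0 <= C & forall n i j, (i <= j <= 2 ^ n)%N ->
    `|f (dyadic t T n j) - f (dyadic t T n i)|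
      <= C * ((j - i)%:R * mesh t T n) `^ gamma.

Section dyadic_grid.
Context {R : realType}.
Variables t T : R.
Hypothesis tT : t < T.
Notation mesh := (mesh t T).
Notation dyadic := (dyadic t T).

Lemma mesh_gt0 n : 0 < mesh n.
Proof. by rewrite divr_gt0 ?subr_gt0 ?exprn_gt0. Qed.

Lemma mesh_le n : mesh n <= T - t.
Proof.
by rewrite ler_pdivrMr ?exprn_gt0// ler_peMr ?subr_ge0 ?(ltW tT)// exprn_ege1 ?ler1n.
Qed.

Lemma mesh2 n q : mesh n = 2 ^+ q * mesh (n + q).
Proof. by rewrite /mesh exprD; field; rewrite !expf_neq0. Qed.

Lemma mesh_cvg0 : mesh n @[n --> \oo] --> 0.
Proof.
rewrite (_ : mesh = fun n => (T - t) * 2^-1 ^+ n); last first.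
  by apply/funext => n; rewrite exprVn.
rewrite -[X in _ --> X](mulr0 (T - t)); apply: cvgMr.
apply: cvg_expr; rewrite ger0_norm ?invr_ge0//.
by rewrite invf_lt1// ltr1n.
Qed.

Lemma mesh_powR_cvg0 p : 0 < p -> mesh n `^ p @[n --> \oo] --> 0.
Proof.
move=> p0; apply/cvgrPdist_lt => e e0.
have e1 : 0 < e `^ p^-1 by rewrite powR_gt0.
move/cvgrPdist_lt : mesh_cvg0 => /(_ _ e1); apply: filterS => n.
rewrite !sub0r !normrN !ger0_norm ?powR_ge0 ?(ltW (mesh_gt0 _))//.
by apply: ltr_powR_root; rewrite // ltW// mesh_gt0.
Qed.

Lemma dyadic0 n : dyadic n 0 = t.
Proof. by rewrite /dyadic mul0r addr0. Qed.

Lemma dyadicB n i j : (i <= j)%N -> dyadic n j - dyadic n i = (j - i)%:R * mesh n.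
Proof. by move=> ij; rewrite /dyadic natrB//; ring. Qed.

Lemma dyadicS n i : dyadic n i.+1 - dyadic n i = mesh n.
Proof. by rewrite dyadicB// subSnn mul1r. Qed.

Lemma dyadic_lt n i j : (i < j)%N -> dyadic n i < dyadic n j.
Proof.
by move=> ij; rewrite -subr_gt0 dyadicB ?(ltnW ij)// mulr_gt0 ?mesh_gt0// ltr0n subn_gt0.
Qed.

Lemma dyadic_refine n q i : dyadic n i = dyadic (n + q) (i * 2 ^ q).
Proof. by rewrite /dyadic natrM natrX (mesh2 n q); ring. Qed.

Lemma dyadic_in n i : (i <= 2 ^ n)%N -> dyadic n i \in `[t, T].
Proof.
move=> i2; rewrite in_itv/= /dyadic lerDl mulr_ge0 ?(ltW (mesh_gt0 n))//=.
rewrite -lerBrDl /mesh mulrCA ler_piMr ?subr_ge0 ?(ltW tT)//.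
by rewrite ler_pdivrMr ?exprn_gt0// mul1r -natrX ler_nat.
Qed.

Lemma dyadic_floor n s : s \in `[t, T] ->
  exists2 i, (i <= 2 ^ n)%N & 0 <= s - dyadic n i <= mesh n.
Proof.
rewrite in_itv/= => /andP[ts sT]; have h0 := mesh_gt0 n.
pose x := (s - t) / mesh n.
have x0 : 0 <= x by rewrite divr_ge0 ?subr_ge0 ?(ltW h0).
have := @truncn_itv _ x x0; set i := Num.truncn x => /andP[ix xi].
exists i.
  rewrite -(ler_nat R) natrX (le_trans ix)// ler_pdivrMr// /mesh mulrCA.
  by rewrite divff ?mulr1 ?lerB// expf_neq0.
rewrite /dyadic opprD addrA; rewrite ler_pdivlMr// in ix.
rewrite ltr_pdivrMr// in xi.
by rewrite -addn1 natrD in xi; lra.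
Qed.

Lemma holder_dyadic (gamma : R) (f : R -> R) : holder_on t T gamma f ->
  holder_dyadic_on t T gamma f.
Proof.
move=> [C HC]; exists `|C| => // n i j /andP[ij jn].
have h0 : 0 <= (j - i)%:R * mesh n by rewrite mulr_ge0// ltW// mesh_gt0.
have := HC _ _ (dyadic_in (leq_trans ij jn)) (dyadic_in jn).
rewrite dyadicB// (ger0_norm h0) => /le_trans; apply.
by rewrite ler_wpM2r ?powR_ge0 ?ler_norm.
Qed.

End dyadic_grid.

(** * Riemann-Stieltjes integrals along dyadic partitions *)

Section uniform_partition.
Context {R : realType}.
Variables t T : R.
Hypothesis tT : t < T.
Notation mesh := (mesh t T).
Notation dyadic := (dyadic t T).

(** The points start after [t], as [itv_partition] expects, and the tags are left end points, which
    makes the sums those of [young_sum_le]. *)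
Let pts (n m : nat) : seq R := [seq dyadic n i.+1 | i <- iota 0 m].
Let tags (n m : nat) : seq R := [seq dyadic n i | i <- iota 0 m].

Let size_pts n m : size (pts n m) = m.
Proof. by rewrite size_map size_iota. Qed.

Let nth_pts x0 n m i : (i < m)%N -> nth x0 (pts n m) i = dyadic n i.+1.
Proof. by move=> im; rewrite (nth_map 0%N) ?size_iota// nth_iota. Qed.

Let nth_tags x0 n m i : (i < m)%N -> nth x0 (tags n m) i = dyadic n i.
Proof. by move=> im; rewrite (nth_map 0%N) ?size_iota// nth_iota. Qed.

Let nth_cons_pts x0 n m i : (i < m)%N -> nth x0 (t :: pts n m) i = dyadic n i.
Proof.
case: i => [|i] im; first by rewrite /= dyadic0.
by rewrite /= nth_pts// ltnW.
Qed.

Let tagged_partition_dyadic n m :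
  tagged_partition t (dyadic n m) (pts n m) (tags n m).
Proof.
split.
- split; last first.
    apply/eqP; case: m => [|m]; first by rewrite dyadic0.
    by rewrite -nth_last size_pts (set_nth_default 0) ?size_pts// nth_pts.
  apply/(pathP t) => i; rewrite size_pts => im.
  by rewrite nth_pts// nth_cons_pts// dyadic_lt.
- by rewrite !size_map.
- move=> i; rewrite size_pts => im.
  by rewrite nth_cons_pts// nth_tags// nth_pts// lexx/= ltW// dyadic_lt.
Qed.

Lemma RS_integral_dyadic (f g : R -> R) n m (l : R) :
  is_RS_integral f g t (dyadic n m) l ->
  forall e, 0 < e -> \forall q \near \oo,
  `|\sum_(0 <= i < m * 2 ^ q)
      f (dyadic (n + q) i) * (g (dyadic (n + q) i.+1) - g (dyadic (n + q) i)) - l|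
    < e.
Proof.
move=> H e e0; have [d d0 Hd] := H _ e0.
have /cvgrPdist_lt/(_ _ d0)[N _ HN] := mesh_cvg0 t T.
exists N => // q Nq.
have : mesh (n + q) < d.
  have := HN (n + q)%N (leq_trans Nq (leq_addl _ _)).
  by rewrite sub0r normrN ger0_norm// ltW// mesh_gt0.
move=> hq.
have := Hd (pts (n + q) (m * 2 ^ q)) (tags (n + q) (m * 2 ^ q)).
rewrite (dyadic_refine t T n q) => /(_ (tagged_partition_dyadic _ _)).
rewrite size_pts => /(_ _)/wrap[].
  by move=> i im; rewrite nth_pts// nth_cons_pts// dyadicS.
congr (`|_ - _| < _); rewrite /RS_sum size_pts big_mkord.
by apply: eq_bigr => i _; rewrite nth_tags// nth_pts// nth_cons_pts.
Qed.

(** Young's estimate is applied to the [2 ^ q] fine cells inside one cell of level [n]. Its bound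
    does not depend on [q], because [mesh (n + q) * 2 ^ q = mesh n], so it survives the limit. Both
    integrals are approximated with the same [q] and subtracted as sums. *)
Lemma RS_integral_increment (f g : R -> R) (a b : R) :
  0 < a -> 0 < b -> 1 < a + b ->
  holder_dyadic_on t T a f -> holder_dyadic_on t T b g ->
  exists2 C : R, 0 <= C & forall n i I J, (i < 2 ^ n)%N ->
    is_RS_integral f g t (dyadic n i) I ->
    is_RS_integral f g t (dyadic n i.+1) J ->
    `|J - I - f (dyadic n i) * (g (dyadic n i.+1) - g (dyadic n i))|
      <= C * mesh n `^ (a + b).
Proof.
move=> a0 b0 ab1 [A A0 HA] [D D0 HD].
exists (young_const (a + b) * (A * D)).
  by apply: mulr_ge0; [exact/ltW/young_const_gt0 | exact: mulr_ge0].
move=> n i I J i2 HI HJ; apply/ler_addgt0Pr => e e0.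
have e2 : 0 < e / 2 by rewrite divr_gt0.
have nI := RS_integral_dyadic HI e2.
have nJ := RS_integral_dyadic HJ e2.
have [q [hI hJ]] : exists q, `|\sum_(0 <= k < i * 2 ^ q)
      f (dyadic (n + q) k) * (g (dyadic (n + q) k.+1) - g (dyadic (n + q) k)) - I|
    < e / 2 /\ `|\sum_(0 <= k < i.+1 * 2 ^ q)
      f (dyadic (n + q) k) * (g (dyadic (n + q) k.+1) - g (dyadic (n + q) k)) - J|
    < e / 2.
  have [q hq] := @filter_ex _ \oo _ _ (filterI nI nJ).
  by exists q.
have h0 k : 0 <= mesh k by exact/ltW/mesh_gt0.
set F := fun k => f (dyadic (n + q) k).
set G := fun k => g (dyadic (n + q) k).
have pw c k : (k%:R * mesh (n + q)) `^ c = mesh (n + q) `^ c * k%:R `^ c.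
  by rewrite powRM// mulrC.
have HF : forall k l, (k <= l <= 2 ^ (n + q))%N ->
    `|F l - F k| <= A * mesh (n + q) `^ a * (l - k)%:R `^ a.
  by move=> k l kl; rewrite -mulrA -pw; exact: HA.
have HG : forall k l, (k <= l <= 2 ^ (n + q))%N ->
    `|G l - G k| <= D * mesh (n + q) `^ b * (l - k)%:R `^ b.
  by move=> k l kl; rewrite -mulrA -pw; exact: HD.
have iq : (i * 2 ^ q + 2 ^ q <= 2 ^ (n + q))%N.
  by rewrite -mulSnr expnD leq_mul2r i2 orbT.
have := young_sum_le (mulr_ge0 A0 (powR_ge0 _ _)) (mulr_ge0 D0 (powR_ge0 _ _))
  a0 b0 ab1 HF HG iq.
rewrite -mulSnr.
rewrite (_ : F (i * 2 ^ q)%N = f (dyadic n i)); last by rewrite /F -dyadic_refine.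
rewrite (_ : G (i * 2 ^ q)%N = g (dyadic n i)); last by rewrite /G -dyadic_refine.
rewrite (_ : G (i.+1 * 2 ^ q)%N = g (dyadic n i.+1)); last first.
  by rewrite /G -dyadic_refine.
have -> : young_const (a + b) *
    (A * mesh (n + q) `^ a * (D * mesh (n + q) `^ b)) * (2 ^ q)%:R `^ (a + b) =
    young_const (a + b) * (A * D) * mesh n `^ (a + b).
  rewrite (mesh2 t T n q) -natrX powRM// [in RHS](powRD (x := mesh (n + q))).
    by ring.
  by apply/implyP => _; rewrite gt_eqF ?mesh_gt0.
have Hsplit : \sum_(0 <= k < i.+1 * 2 ^ q) F k * (G k.+1 - G k) =
    \sum_(0 <= k < i * 2 ^ q) F k * (G k.+1 - G k) +
    \sum_(i * 2 ^ q <= k < i.+1 * 2 ^ q) F k * (G k.+1 - G k).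
  by rewrite -big_cat_nat//= leq_mul2r leqnSn orbT.
move: hI hJ; rewrite -/F -/G.
rewrite -[in X in X -> _ -> _]/(\sum_(0 <= k < i * 2 ^ q) F k * (G k.+1 - G k)).
rewrite -[in X in _ -> X -> _]/(\sum_(0 <= k < i.+1 * 2 ^ q) F k * (G k.+1 - G k)).
rewrite Hsplit; move: (\sum_(0 <= k < i * 2 ^ q) _) => SI.
move: (\sum_(i * 2 ^ q <= k < _) _) (f _ * _) => S p.
rewrite !ltr_norml !ler_norml => /andP[? ?] /andP[? ?] /andP[? ?].
by apply/andP; split; lra.
Qed.

End uniform_partition.

(** * Hölder functions, their compositions and their integrals *)

Section holder_functions.
Context {R : realType}.
Variables t T : R.
Implicit Types f g : R -> R.

Lemma holder_onP (gamma : R) f : holder_on t T gamma f ->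
  exists2 C : R, 0 <= C & forall r s, r \in `[t, T] -> s \in `[t, T] ->
    `|f s - f r| <= C * `|s - r| `^ gamma.
Proof.
move=> [C HC]; exists `|C| => // r s rT sT.
by rewrite (le_trans (HC _ _ rT sT))// ler_wpM2r ?powR_ge0 ?ler_norm.
Qed.

Lemma itv_dist_le (r s : R) : r \in `[t, T] -> s \in `[t, T] ->
  0 <= `|s - r| <= T - t.
Proof.
rewrite !in_itv/= normr_ge0/= => /andP[? ?] /andP[? ?].
by rewrite ler_norml; lra.
Qed.

Lemma holder_bounded (gamma : R) f : 0 < gamma -> holder_on t T gamma f ->
  exists2 M : R, 0 < M & forall s, s \in `[t, T] -> `|f s| <= M.
Proof.
move=> g0 /holder_onP[C C0 HC].
exists (`|f t| + C * (T - t) `^ gamma + 1).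
  by rewrite ltr_wpDl// addr_ge0// mulr_ge0// powR_ge0.
move=> s sT; have tI : t \in `[t, T].
  by move: sT; rewrite !in_itv/= lexx/= => /andP[]; exact: le_trans.
have /andP[_ d] := itv_dist_le tI sT.
have h := HC _ _ tI sT.
have : C * `|s - t| `^ gamma <= C * (T - t) `^ gamma.
  by rewrite ler_wpM2l// ge0_ler_powR ?nnegrE ?(ltW g0) ?(le_trans _ d).
have := ler_normD (f t) (f s - f t); rewrite addrC subrK.
lra.
Qed.

Lemma holder_continuous (gamma : R) f : 0 < gamma -> holder_on t T gamma f ->
  {within `[t, T], continuous f}.
Proof.
move=> g0 /holder_onP[C C0 HC].
apply/subspace_continuousP => x xT.
apply/cvgrPdist_lt => e e0; rewrite near_withinE /=.
have e1 : 0 < e / (C + 1) by rewrite divr_gt0// ltr_wpDl.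
have d0 : 0 < (e / (C + 1)) `^ gamma^-1 by rewrite powR_gt0.
have := nbhsx_ballx x _ d0; apply: filterS => y /= xy yT.
rewrite (le_lt_trans (HC _ _ yT xT))//.
have : `|x - y| `^ gamma < e / (C + 1) by apply: ltr_powR_root.
rewrite ltr_pdivlMr ?ltr_wpDl// => h; rewrite (le_lt_trans _ h)//.
by rewrite mulrC ler_wpM2l ?powR_ge0// lerDl.
Qed.

(** A Lipschitz bound that is local in space is enough because [f] is bounded. This serves [b],
    which is only locally Lipschitz, as well as [sigma]. *)
Lemma holder_comp (p q : R) f (F : R -> R -> R) : 0 < p -> 0 < q ->
  holder_on t T q f ->
  (forall rho : R, 0 < rho -> exists2 L : R, 0 < L &
     forall r s x y, r \in `[t, T] -> s \in `[t, T] ->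
       `|x| <= rho -> `|y| <= rho ->
       `|F s y - F r x| <= L * (`|s - r| `^ p + `|y - x|)) ->
  holder_on t T (Num.min p q) (fun r => F r (f r)).
Proof.
move=> p0 q0 Hf HF; have [M M0 HM] := holder_bounded q0 Hf.
have [L L0 HL] := HF _ M0; have [C C0 HC] := holder_onP Hf.
have m0 : 0 < Num.min p q by rewrite lt_min p0.
exists (L * ((T - t) `^ (p - Num.min p q) + C * (T - t) `^ (q - Num.min p q))).
move=> r s rT sT; rewrite (le_trans (HL _ _ _ _ rT sT (HM _ rT) (HM _ sT)))//.
rewrite -mulrA ler_wpM2l ?(ltW L0)// mulrDl lerD//.
  by rewrite ler_powR_base ?itv_dist_le// m0 ge_min lexx.
rewrite (le_trans (HC _ _ rT sT))// -mulrA ler_wpM2l//.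
by rewrite ler_powR_base ?itv_dist_le// m0 ge_min lexx orbT.
Qed.

(** The difference is the integral of [f r - f u] over an interval of length [v - u], on which the
    integrand is at most [C * (v - u) ^ c]. *)
Lemma Rintegral_holder_increment (c : R) f : 0 < c -> holder_on t T c f ->
  exists2 C : R, 0 <= C & forall u v, u \in `[t, T] -> v \in `[t, T] -> u <= v ->
    `|\int[lebesgue_measure]_(r in `[t, v]) f r
      - \int[lebesgue_measure]_(r in `[t, u]) f r - f u * (v - u)|
      <= C * (v - u) `^ (1 + c).
Proof.
move=> c0 Hf; have [C C0 HC] := holder_onP Hf; exists C => // u v uT vT uv.
have tu : t <= u by move: uT; rewrite in_itv/= => /andP[].
have vT' : v <= T by move: vT; rewrite in_itv/= => /andP[].
have itf : lebesgue_measure.-integrable `[t, T] (EFin \o f).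
  apply: continuous_compact_integrable; first exact: segment_compact.
  exact: holder_continuous Hf.
have itfv : lebesgue_measure.-integrable `[t, v] (EFin \o f).
  by apply: integrableS itf => //; apply: subset_itvl; rewrite bnd_simp.
have ituv : lebesgue_measure.-integrable `]u, v] (EFin \o f).
  apply: integrableS itfv => //; apply: subset_itvr; rewrite bnd_simp//.
have itc k : lebesgue_measure.-integrable `]u, v] (EFin \o cst k).
  have : lebesgue_measure.-integrable `[u, v] (EFin \o cst k).
    apply: continuous_compact_integrable; first exact: segment_compact.
    by apply: continuous_subspaceT => x; exact: cvg_cst.
  by apply: integrableS => //; apply: subset_itvr; rewrite bnd_simp.
have mass : fine (lebesgue_measure (`]u, v]%classic : set R)) = v - u.
  rewrite lebesgue_measure_itv/= lte_fin; case: ltP => //= vu.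
  by apply/esym/eqP; rewrite subr_eq0 eq_le uv vu.
rewrite Rintegral_itvB ?bnd_simp//.
have -> : f u * (v - u) = \int[lebesgue_measure]_(r in `]u, v]) (cst (f u) r).
  by rewrite Rintegral_cst ?mass.
rewrite -RintegralB//.
have itd : lebesgue_measure.-integrable `]u, v] (EFin \o (fun x => f x - cst (f u) x)).
  exact: (integrableB _ ituv (itc (f u))).
rewrite (le_trans (le_normr_Rintegral _ _))//.
rewrite (_ : C * _ =
  \int[lebesgue_measure]_(r in `]u, v]) (cst (C * (v - u) `^ c) r)); last first.
  rewrite Rintegral_cst ?mass// -mulrA; congr (C * _).
  by rewrite powRD ?powRr1 ?subr_ge0 ?(gt_eqF (addr_gt0 ltr01 c0))// mulrC.
apply: le_Rintegral => //=.
  exact: (integrable_norm itd).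
move=> x; rewrite /= in_itv/= => /andP[ux xv].
rewrite (le_trans (HC _ _ uT _)) ?in_itv/= ?(le_trans tu (ltW ux)) ?(le_trans xv)//.
rewrite ler_wpM2l// ge0_ler_powR ?nnegrE ?subr_ge0 ?(ltW c0)//.
by rewrite ger0_norm ?subr_ge0 ?(ltW ux)// lerB.
Qed.

End holder_functions.

(** * Comparison of paths *)

Lemma mesh_powR_small {R : realType} (t T K p eps : R) : t < T -> 0 < p ->
  0 < eps -> \forall n \near \oo, K * mesh t T n `^ p < eps.
Proof.
move=> tT p0 e0.
have /cvgrPdist_lt/(_ _ e0) : K * mesh t T n `^ p @[n --> \oo] --> 0.
  by rewrite -[X in _ --> X](mulr0 K); apply: cvgMr; exact: mesh_powR_cvg0.
apply: filterS => n.
by rewrite sub0r normrN; apply: le_lt_trans; exact: ler_norm.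
Qed.

(** A discrete Gronwall inequality for the negative part. Where [z i >= 0], the bound
    [|a i| + l <= 1] keeps the linear part nonnegative, so at most [e] is lost; where [z i < 0],
    [- z i] grows by a factor of at most [expR (a i + l)]. Only signed sums of [a] enter the
    exponent: Young's estimate bounds these, but not sums of [|a i|]. *)
Lemma discrete_comparison {R : realType} (z a : nat -> R) (N : nat) (l e M : R) :
  0 <= l -> 0 <= e -> 0 <= z 0%N ->
  (forall i, (i < N)%N -> `|a i| + l <= 1) ->
  (forall i, (i < N)%N -> (1 + a i) * z i - l * `|z i| - e <= z i.+1) ->
  (forall j k, (j <= k <= N)%N -> \sum_(j <= i < k) a i <= M) ->
  forall k, (k <= N)%N -> - z k <= e * k%:R * expR (M + l * N%:R).
Proof.
move=> l0 e0 z0 al1 zS HM.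
(* Each step injects an error [e], which the later steps amplify by their factors
   [expR (a i + l)]. *)
have key k : (k <= N)%N -> - z k <=
    e * \sum_(0 <= j < k) expR (\sum_(j.+1 <= i < k) a i + l * (k - j.+1)%:R).
  elim: k => [|k IHk] kN; first by rewrite big_geq// mulr0 oppr_le0.
  have {IHk} := IHk (ltnW kN).
  set S := \sum_(0 <= j < k) _ => IHk.
  have S0 : 0 <= S by apply: sumr_ge0 => j _; exact: expR_ge0.
  rewrite big_nat_recr//= (big_geq (m := k.+1))// subnn mulr0 addr0 expR0 mulrDr mulr1.
  have -> : \sum_(0 <= j < k)
      expR (\sum_(j.+1 <= i < k.+1) a i + l * (k.+1 - j.+1)%:R) =
      expR (a k + l) * S.
    rewrite /S big_distrr/=; apply: eq_big_nat => j /andP[_ jk].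
    rewrite -expRD big_nat_recr//=; congr expR.
    by rewrite subSS -(subnSK jk) -natr1; ring.
  have := zS _ kN; have := al1 _ kN; have := expR_ge1Dx (a k + l).
  have := ler_norm (a k); have := ler_norm (- a k); rewrite normrN.
  have [zk0|zk0] := lerP 0 (z k) => h1 h2 h3 h4 h5.
    rewrite ger0_norm// in h5.
    have : 0 <= (1 + a k - l) * z k by rewrite mulr_ge0//; lra.
    have : 0 <= e * (expR (a k + l) * S) by rewrite !mulr_ge0 ?expR_ge0.
    by lra.
  rewrite ltr0_norm// in h5.
  have : (1 + (a k + l)) * - z k <= expR (a k + l) * (e * S).
    by rewrite ler_pM//; lra.
  by lra.
move=> k kN; rewrite (le_trans (key k kN))// -mulrA ler_wpM2l//.
have : \sum_(0 <= j < k) expR (\sum_(j.+1 <= i < k) a i + l * (k - j.+1)%:R) <=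
    \sum_(0 <= j < k) expR (M + l * N%:R).
  apply: ler_sum_nat => j /andP[_ jk]; rewrite ler_expR lerD//.
    by apply: HM; rewrite jk kN.
  by rewrite ler_wpM2l// ler_nat (leq_trans (leq_subr _ _)).
by rewrite sumr_const_nat subn0 mulr_natl.
Qed.

(** * Divided differences of the diffusion coefficient *)

Section slope.
Context {R : realType}.
Implicit Type f : R -> R.

(* The mean of [f^`()] over the segment from [x] to [y]. *)
Definition slope f (x y : R) : R :=
  if x == y then derive1 f x else (f y - f x) / (y - x).

Lemma slopeM f x y : f y - f x = slope f x y * (y - x).
Proof.
rewrite /slope; case: eqVneq => [->|xy]; first by rewrite !subrr mulr0.
by rewrite divfK// subr_eq0 eq_sym.
Qed.

Lemma slope_primitive f x y : (forall z, derivable f z 1) ->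
  exists2 psi : R -> R, psi 1 - psi 0 = slope f x y &
    forall u : R, is_derive u (1 : R) psi (derive1 f (x + u * (y - x))).
Proof.
move=> df; rewrite /slope; case: eqVneq => [->|xy].
  exists (fun u => derive1 f y * u); first by rewrite mulr1 mulr0 subr0.
  by move=> u; apply: is_derive_eq; rewrite subrr mulr0 addr0 scaler1.
have yx0 : y - x != 0 by rewrite subr_eq0 eq_sym.
exists (fun u => (y - x)^-1 * f (x + u * (y - x))).
  by rewrite mul1r mul0r addr0 (addrC x) subrK -mulrBr mulrC.
move=> u.
have h1 : is_derive u 1 (fun u : R => x + u * (y - x)) (y - x).
  by apply: is_derive_eq; rewrite add0r scaler0 add0r mul1r; exact: mulr1.
have h2 : is_derive (x + u * (y - x)) 1 f (derive1 f (x + u * (y - x))).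
  by rewrite derive1E; apply/derivableP.
have h3 := @is_derive1_comp R f (fun u => x + u * (y - x)) u _ _ h2 h1.
apply: is_derive_eq.
by exact: etrans (mulrC _ _) (mulfK yx0 _).
Qed.

(** The mean value theorem is applied once, to the difference of the two primitives, so that the
    same parameter [c] serves both slopes. Two separate applications would give unrelated
    intermediate points. *)
Lemma slope_dist_le f (g : R -> R) (x y x' y' M : R) :
  (forall z, derivable f z 1) -> (forall z, derivable g z 1) ->
  (forall u, 0 <= u <= 1 ->
    `|derive1 f (x + u * (y - x)) - derive1 g (x' + u * (y' - x'))| <= M) ->
  `|slope f x y - slope g x' y'| <= M.
Proof.
move=> df dg HM.
have [p <- dp] := slope_primitive x y df.
have [q <- dq] := slope_primitive x' y' dg.
pose pq u := p u - q u.
have dpq (u : R) : is_derive u (1 : R) pq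
    (derive1 f (x + u * (y - x)) - derive1 g (x' + u * (y' - x'))).
  by apply: is_deriveB.
have cpq : {within `[0, 1], continuous pq}.
  apply: derivable_within_continuous => u _.
  by have /@ex_derive := dpq u.
have [c] := MVT ltr01 (fun u _ => dpq u) cpq.
rewrite in_itv/= subr0 mulr1 => /andP[c0 c1] E.
rewrite (_ : _ - _ = pq 1 - pq 0); last by rewrite /pq; ring.
by rewrite E HM// (ltW c0) (ltW c1).
Qed.

Lemma conv_dist_le (x y x' y' u : R) : 0 <= u <= 1 ->
  `|x + u * (y - x) - (x' + u * (y' - x'))| <= `|x - x'| + `|y - y'|.
Proof.
move=> /andP[u0 u1].
rewrite (_ : _ - _ = (1 - u) * (x - x') + u * (y - y')); last by ring.
rewrite (le_trans (ler_normD _ _))// lerD// normrM ger0_norm ?subr_ge0//.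
  by rewrite ler_piMl// gerBl.
by rewrite ler_piMl.
Qed.

Lemma conv_norm_le (x y u M : R) : 0 <= u <= 1 -> `|x| <= M -> `|y| <= M ->
  `|x + u * (y - x)| <= M.
Proof.
move=> /andP[u0 u1] xM yM.
rewrite (_ : x + _ = (1 - u) * x + u * y); last by ring.
have u1' : 0 <= 1 - u by rewrite subr_ge0.
rewrite (le_trans (ler_normD _ _))// !normrM (ger0_norm u0) (ger0_norm u1').
have := ler_wpM2l u0 yM; have : (1 - u) * `|x| <= (1 - u) * M.
  by rewrite ler_wpM2l.
lra.
Qed.

(** Matched points of the segments from [X] to [Y] at times [r] and [s] are at distance at most
    [(CX + CY) * |s - r| ^ gamma]. The Hölder condition of order [delta] on the derivative of
    [sigma] then yields the order [delta * gamma]. *)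
Lemma slope_holder (t T beta delta gamma : R) (sigma : R -> R -> R)
    (X Y : R -> R) :
  0 <= t -> 0 < gamma -> hyp_H1 T beta delta sigma ->
  holder_on t T gamma X -> holder_on t T gamma Y ->
  holder_on t T (Num.min beta (delta * gamma))
    (fun r => slope (sigma r) (X r) (Y r)).
Proof.
move=> t0 g0 [/andP[b0 b1] /andP[d0 d1] ds _ H] HX HY.
have [MX MX0 HMX] := holder_bounded g0 HX.
have [MY MY0 HMY] := holder_bounded g0 HY.
have [CX CX0 HCX] := holder_onP HX; have [CY CY0 HCY] := holder_onP HY.
have [K K0 HK] := H _ (addr_gt0 MX0 MY0).
have m0 : 0 < Num.min beta (delta * gamma) by rewrite lt_min b0 mulr_gt0.
set m := Num.min _ _ in m0 *.
exists (K * ((T - t) `^ (beta - m) +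
  (CX + CY) `^ delta * (T - t) `^ (delta * gamma - m))) => r s rT sT.
have tT x : x \in `[t, T] -> x \in `[0, T].
  by rewrite !in_itv/= => /andP[/(le_trans t0)->].
have XM x : x \in `[t, T] -> `|X x| <= MX + MY.
  by move=> /HMX/le_trans; apply; rewrite lerDl ltW.
have YM x : x \in `[t, T] -> `|Y x| <= MX + MY.
  by move=> /HMY/le_trans; apply; rewrite lerDr ltW.
have h := itv_dist_le rT sT.
apply: slope_dist_le => [z|z|u u01]; [exact/ds/tT|exact/ds/tT|].
rewrite (le_trans (HK _ _ _ _ (tT _ rT) (tT _ sT)
  (conv_norm_le u01 (XM _ sT) (YM _ sT)) (conv_norm_le u01 (XM _ rT) (YM _ rT))))//.
rewrite -mulrA ler_wpM2l ?(ltW K0)// mulrDl lerD//.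
  by rewrite ler_powR_base// m0 ge_min lexx.
apply: (@le_trans _ _ (((CX + CY) * `|s - r| `^ gamma) `^ delta)).
  rewrite ge0_ler_powR ?nnegrE ?(ltW d0)// ?mulr_ge0 ?addr_ge0 ?powR_ge0//.
  by rewrite (le_trans (conv_dist_le _ _ _ _ u01))// mulrDl lerD ?HCX ?HCY.
rewrite powRM ?addr_ge0 ?powR_ge0// -mulrA ler_wpM2l ?powR_ge0//.
rewrite -powRrM [gamma * _]mulrC.
by rewrite ler_powR_base// m0 ge_min lexx orbT.
Qed.

End slope.

Lemma alpha0_le_half {R : realType} (beta delta : R) : alpha0 beta delta <= 2^-1.
Proof. by rewrite /alpha0 ge_min lexx. Qed.

Lemma hyp_H2_mu_gt0 {R : realType} (T beta delta mu : R) b :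
  hyp_H2 T beta delta mu b -> 0 < mu.
Proof. by case=> /andP[h _] _ _; have := alpha0_le_half beta delta; lra. Qed.

(** The first term is the order of the error in the drift integral over one cell, the second that of
    Young's estimate for the integral against [B]. *)
Definition step_order {R : realType} (beta gamma mu : R) : R :=
  Num.min (1 + Num.min mu gamma) (Num.min beta gamma + gamma).

(** * One-step expansion of a solution along the grid *)

Section path_expansion.
Context {R : realType}.
Variables t T beta delta mu gamma : R.
Hypotheses (t0 : 0 <= t) (tT : t < T) (gamma0 : 0 < gamma).
Hypotheses (bg1 : 1 < beta + gamma) (g1 : 1 < gamma + gamma).
Notation mesh := (mesh t T).
Notation dyadic := (dyadic t T).

Let sub0 x : x \in `[t, T] -> x \in `[0, T].
Proof. by rewrite !in_itv/= => /andP[/(le_trans t0)->]. Qed.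

Lemma step_order_gt1 : 0 < mu -> 1 < step_order beta gamma mu.
Proof.
move=> mu0; rewrite /step_order lt_min ltrDl lt_min mu0 gamma0/=.
by rewrite -ltrBlDr lt_min !ltrBlDr bg1 g1.
Qed.

Variables (b sigma : R -> R -> R) (g : R -> R).
Hypotheses (Hsigma : hyp_H1 T beta delta sigma) (Hb : hyp_H2 T beta delta mu b).
Hypothesis Hg : holder_dyadic_on t T gamma g.
Variables (x : R) (X : R -> R).
Hypothesis HX : holder_on t T gamma X.
Hypothesis X_eq : forall s, s \in `[t, T] ->
  exists2 I, is_RS_integral (fun r => sigma r (X r)) g t s I &
    X s = x + \int[lebesgue_measure]_(r in `[t, s]) b r (X r) + I.

Lemma path_expansion : exists2 C : R, 0 <= C & forall n i, (i < 2 ^ n)%N ->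
  `|X (dyadic n i.+1) - X (dyadic n i)
    - b (dyadic n i) (X (dyadic n i)) * mesh n
    - sigma (dyadic n i) (X (dyadic n i)) * (g (dyadic n i.+1) - g (dyadic n i))|
    <= C * mesh n `^ step_order beta gamma mu.
Proof.
have mu0 := hyp_H2_mu_gt0 Hb.
have [/andP[beta0 _] _ _ [M0 M00 HM0] _] := Hsigma.
have [_ bloc _] := Hb.
have e1 := step_order_gt1 mu0; set e := step_order _ _ _ in e1 *.
have sH : holder_on t T (Num.min beta gamma) (fun r => sigma r (X r)).
  apply: holder_comp => // rho rho0; exists M0 => // r s y z rT sT _ _.
  exact/HM0/sub0/sT/sub0/rT.
have bH : holder_on t T (Num.min mu gamma) (fun r => b r (X r)).
  apply: holder_comp => // rho rho0; have [L L0 HL] := bloc _ (ltW rho0).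
  exists L => // r s y z rT sT yr zr.
  exact: (HL _ _ _ _ (sub0 rT) (sub0 sT) zr yr).
have m0 : 0 < Num.min beta gamma by rewrite lt_min beta0.
have c0 : 0 < Num.min mu gamma by rewrite lt_min mu0.
have mg1 : 1 < Num.min beta gamma + gamma.
  by rewrite -ltrBlDr lt_min !ltrBlDr bg1 g1.
have [C1 C10 H1] := Rintegral_holder_increment c0 bH.
have [C2 C20 H2] :=
  RS_integral_increment tT m0 gamma0 mg1 (holder_dyadic tT sH) Hg.
exists (C1 * (T - t) `^ (1 + Num.min mu gamma - e) +
        C2 * (T - t) `^ (Num.min beta gamma + gamma - e)).
  by rewrite addr_ge0// mulr_ge0// powR_ge0.
move=> n i i2; set p := dyadic n i; set q := dyadic n i.+1.
have pT : p \in `[t, T] by apply: dyadic_in => //; exact: ltnW.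
have qT : q \in `[t, T] by exact: dyadic_in.
have pq : p <= q by exact/ltW/dyadic_lt.
have [I HI XI] := X_eq pT; have [J HJ XJ] := X_eq qT.
have hb := H1 _ _ pT qT pq; rewrite [q - p]dyadicS in hb.
have hs := H2 _ _ _ _ i2 HI HJ.
have h0 : 0 <= mesh n <= T - t by rewrite ltW ?mesh_gt0//= mesh_le.
have e0 : 0 < e by rewrite (lt_trans ltr01).
have w1 : mesh n `^ (1 + Num.min mu gamma) <=
    (T - t) `^ (1 + Num.min mu gamma - e) * mesh n `^ e.
  by rewrite ler_powR_base// e0 ge_min lexx.
have w2 : mesh n `^ (Num.min beta gamma + gamma) <=
    (T - t) `^ (Num.min beta gamma + gamma - e) * mesh n `^ e.
  by rewrite ler_powR_base// e0 ge_min lexx orbT.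
rewrite (_ : _ - _ =
  (\int[lebesgue_measure]_(r in `[t, q]) b r (X r)
    - \int[lebesgue_measure]_(r in `[t, p]) b r (X r) - b p (X p) * mesh n)
  + (J - I - sigma p (X p) * (g q - g p))); last by rewrite XI XJ; ring.
rewrite mulrDl (le_trans (ler_normD _ _))// lerD//.
  by rewrite (le_trans hb)// -mulrA ler_wpM2l.
by rewrite (le_trans hs)// -mulrA ler_wpM2l.
Qed.

End path_expansion.

Lemma path_start {R : realType} (t T x : R) (b sigma : R -> R -> R) (g X : R -> R) :
  t <= T ->
  (forall s, s \in `[t, T] ->
    exists2 I, is_RS_integral (fun r => sigma r (X r)) g t s I &
      X s = x + \int[lebesgue_measure]_(r in `[t, s]) b r (X r) + I) ->
  X t = x.
Proof.
move=> tT X_eq.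
have [|I HI ->] := X_eq t; first by rewrite in_itv/= lexx.
rewrite set_itv1 Rintegral_set1 addr0.
suff -> : I = 0 by rewrite addr0.
apply/eqP; rewrite -normr_le0; apply/ler_addgt0Pr => e e0.
(* The empty partition is a tagged partition of the interval from [t] to [t], and its sum is 0. *)
have [d _ /(_ [::] [::])] := HI _ e0.
by rewrite /RS_sum big_ord0 sub0r normrN add0r => H; apply/ltW/H.
Qed.

(** * Sufficiency along a single path *)

Section path_comparison.
Context {R : realType}.
Variables t T beta delta mu gamma : R.
Hypotheses (t0 : 0 <= t) (tT : t < T) (gamma0 : 0 < gamma).
Hypotheses (bg1 : 1 < beta + gamma) (g1 : 1 < gamma + gamma).
Hypothesis dg1 : 1 < delta * gamma + gamma.
Notation mesh := (mesh t T).
Notation dyadic := (dyadic t T).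
Notation e := (step_order beta gamma mu).

Let sub0 x : x \in `[t, T] -> x \in `[0, T].
Proof. by rewrite !in_itv/= => /andP[/(le_trans t0)->]. Qed.

Variables (b1 b2 sigma1 sigma2 : R -> R -> R) (g X Y : R -> R).
Hypothesis Hg : holder_dyadic_on t T gamma g.
Hypotheses (HX : holder_on t T gamma X) (HY : holder_on t T gamma Y).
Hypotheses (b1H : hyp_H2 T beta delta mu b1).
Variable C : R.
Hypotheses (C0 : 0 <= C).
Hypothesis XE : forall n i, (i < 2 ^ n)%N ->
  `|X (dyadic n i.+1) - X (dyadic n i)
    - b1 (dyadic n i) (X (dyadic n i)) * mesh n
    - sigma1 (dyadic n i) (X (dyadic n i)) * (g (dyadic n i.+1) - g (dyadic n i))|
    <= C * mesh n `^ e.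
Hypothesis YE : forall n i, (i < 2 ^ n)%N ->
  `|Y (dyadic n i.+1) - Y (dyadic n i)
    - b2 (dyadic n i) (Y (dyadic n i)) * mesh n
    - sigma2 (dyadic n i) (Y (dyadic n i)) * (g (dyadic n i.+1) - g (dyadic n i))|
    <= C * mesh n `^ e.

Lemma path_comparison : X t <= Y t ->
  (forall s z, s \in `[0, T] -> b1 s z <= b2 s z /\ sigma1 s z = sigma2 s z) ->
  hyp_H1 T beta delta sigma1 ->
  forall s, s \in `[t, T] -> X s <= Y s.
Proof.
move=> XYt b12 sH.
have mu0 := hyp_H2_mu_gt0 b1H.
have e1 : 1 < e by exact: step_order_gt1.
have [/andP[beta0 _] /andP[delta0 _] _ _ _] := sH.
have [_ bloc _] := b1H.
have [MX MX0 HMX] := holder_bounded gamma0 HX.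
have [MY MY0 HMY] := holder_bounded gamma0 HY.
have [L L0 HL] := bloc _ (ltW (addr_gt0 MX0 MY0)).
pose theta r := slope (sigma1 r) (X r) (Y r).
have thH : holder_on t T (Num.min beta (delta * gamma)) theta.
  exact: slope_holder.
have m0 : 0 < Num.min beta (delta * gamma) by rewrite lt_min beta0 mulr_gt0.
have mg1 : 1 < Num.min beta (delta * gamma) + gamma.
  by rewrite -ltrBlDr lt_min !ltrBlDr bg1 dg1.
have [Mth Mth0 HMth] := holder_bounded m0 thH.
have [A A0 HA] := holder_dyadic tT thH.
have [D D0 HD] := Hg.
set m := Num.min beta (delta * gamma) in thH m0 mg1 HA *.
(* The sum of [theta] against the increments of [g] over a block is [theta] at its left end times
   the total increment, bounded by the first term, up to Young's remainder, bounded by the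
   second. *)
pose K := Mth * (D * (T - t) `^ gamma) +
  young_const (m + gamma) * (A * D) * (T - t) `^ (m + gamma).
have h0 n : 0 < mesh n by exact: mesh_gt0.
have len n k : (k <= 2 ^ n)%N -> 0 <= k%:R * mesh n <= T - t.
  move=> kn; rewrite mulr_ge0 ?(ltW (h0 n))//=.
  by have := dyadic_in tT kn; rewrite in_itv/= /dyadic; lra.
have thsum n j k : (j <= k <= 2 ^ n)%N ->
    \sum_(j <= i < k)
      theta (dyadic n i) * (g (dyadic n i.+1) - g (dyadic n i)) <= K.
  move=> /andP[jk kn].
  pose F i := theta (dyadic n i); pose G i := g (dyadic n i).
  have HF u v : (u <= v <= 2 ^ n)%N ->
      `|F v - F u| <= A * mesh n `^ m * (v - u)%:R `^ m.
    by move=> /HA; rewrite powRM ?(ltW (h0 _))// mulrAC mulrA.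
  have HG u v : (u <= v <= 2 ^ n)%N ->
      `|G v - G u| <= D * mesh n `^ gamma * (v - u)%:R `^ gamma.
    by move=> /HD; rewrite powRM ?(ltW (h0 _))// mulrAC mulrA.
  have kn' : (j + (k - j) <= 2 ^ n)%N by rewrite subnKC.
  have := young_sum_le (mulr_ge0 A0 (powR_ge0 _ _)) (mulr_ge0 D0 (powR_ge0 _ _))
    m0 gamma0 mg1 HF HG kn'.
  rewrite subnKC// (_ : _ * _ * _ `^ _ = young_const (m + gamma) * (A * D) *
    ((k - j)%:R * mesh n) `^ (m + gamma)); last first.
    rewrite powRM ?(ltW (h0 _))// [mesh n `^ (_ + _)]powRD; first by ring.
    by apply/implyP => _; rewrite gt_eqF.
  have jT : dyadic n j \in `[t, T] by exact/dyadic_in/(leq_trans jk).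
  have lkj := len n (k - j)%N (leq_trans (leq_subr _ _) kn).
  have p1 : `|F j * (G k - G j)| <= Mth * (D * (T - t) `^ gamma).
    rewrite normrM ler_pM ?HMth//.
    have := HD n j k; rewrite jk kn => /(_ erefl)/le_trans; apply.
    case/andP: lkj => ? ?; rewrite ler_wpM2l// ge0_ler_powR ?nnegrE ?(ltW gamma0)//.
    by rewrite subr_ge0 ltW.
  have p2 : young_const (m + gamma) * (A * D) *
      ((k - j)%:R * mesh n) `^ (m + gamma) <=
      young_const (m + gamma) * (A * D) * (T - t) `^ (m + gamma).
    case/andP: lkj => ? ?; rewrite ler_wpM2l//.
      by apply: mulr_ge0; [exact/ltW/young_const_gt0|exact: mulr_ge0].
    by rewrite ge0_ler_powR ?nnegrE ?subr_ge0 ?(ltW tT)// ltW// (lt_trans ltr01).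
  move=> hS; rewrite -[leLHS]/(\sum_(j <= i < k) F i * (G i.+1 - G i)) /K.
  move: hS p1 p2; move: (\sum_(j <= i < k) _) => S.
  by rewrite !ler_norml => /andP[_ ?] /andP[_ ?] ?; lra.
(* The smallness condition of [discrete_comparison] holds on fine grids only; each of its two terms
   is brought below one half. *)
have small : \forall n \near \oo, (forall i, (i < 2 ^ n)%N ->
    `|theta (dyadic n i) * (g (dyadic n i.+1) - g (dyadic n i))| + L * mesh n <= 1).
  have half : 0 < 2^-1 :> R by rewrite invr_gt0.
  have s1 := mesh_powR_small (Mth * D) tT gamma0 half.
  have s2 := mesh_powR_small L tT ltr01 half.
  apply: filterS (filterI s1 s2) => n [/= h1 h2] i i2.
  rewrite powRr1 ?(ltW (h0 _))// in h2.
  have iT : dyadic n i \in `[t, T] by exact/dyadic_in/ltnW.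
  have : `|theta (dyadic n i) * (g (dyadic n i.+1) - g (dyadic n i))| <=
      Mth * D * mesh n `^ gamma.
    rewrite normrM -mulrA ler_pM ?HMth//.
    have := HD n i i.+1; rewrite leqnSn i2 => /(_ erefl).
    by rewrite subSnn mul1r.
  by lra.
pose W := 2 * C * (T - t) * expR (K + L * (T - t)).
have grid : \forall n \near \oo, forall k, (k <= 2 ^ n)%N ->
    - (Y (dyadic n k) - X (dyadic n k)) <= W * mesh n `^ (e - 1).
  apply: filterS small => n al1 k k2.
  pose z i := Y (dyadic n i) - X (dyadic n i).
  have step i : (i < 2 ^ n)%N -> (1 + theta (dyadic n i) * (g (dyadic n i.+1) -
      g (dyadic n i))) * z i - L * mesh n * `|z i| - 2 * C * mesh n `^ e <= z i.+1.
    move=> i2; have iT : dyadic n i \in `[t, T] by exact/dyadic_in/ltnW.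
    have := XE i2; have := YE i2.
    have [bb ss] := b12 _ (Y (dyadic n i)) (sub0 iT); rewrite -ss => hY hX.
    (* The comparison passes through [b1] at the point [Y]: the ordering of the drifts is used
       there, then the local Lipschitz bound of [b1] between [X] and [Y]. *)
    have hb : - (L * `|z i|) <= b2 (dyadic n i) (Y (dyadic n i)) -
        b1 (dyadic n i) (X (dyadic n i)).
      have xM : `|X (dyadic n i)| <= MX + MY.
        by rewrite (le_trans (HMX _ iT))// lerDl ltW.
      have yM : `|Y (dyadic n i)| <= MX + MY.
        by rewrite (le_trans (HMY _ iT))// lerDr ltW.
      have := HL _ _ _ _ (sub0 iT) (sub0 iT) yM xM.
      rewrite subrr normr0 powR0 ?gt_eqF// add0r ler_norml => /andP[h _].
      by rewrite (le_trans h)// lerB.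
    have hbh := ler_wpM2r (ltW (h0 n)) hb.
    have hs := congr1 (fun u => u * (g (dyadic n i.+1) - g (dyadic n i)))
      (slopeM (sigma1 (dyadic n i)) (X (dyadic n i)) (Y (dyadic n i))).
    rewrite -/(theta (dyadic n i)) /= -/(z i) in hs.
    move: hX hY; rewrite !ler_norml => /andP[_ hX] /andP[hY _].
    have zE : z i.+1 - z i = Y (dyadic n i.+1) - Y (dyadic n i)
       - (X (dyadic n i.+1) - X (dyadic n i)) by rewrite /z; ring.
    by lra.
  have E0 : 0 <= 2 * C * mesh n `^ e by rewrite !mulr_ge0 ?powR_ge0.
  have z0 : 0 <= z 0%N by rewrite /z !dyadic0 subr_ge0.
  have Lh0 : 0 <= L * mesh n by rewrite mulr_ge0 ?ltW.
  have := discrete_comparison Lh0 E0 z0 al1 step (thsum n) k2.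
  move=> /le_trans; apply.
  have -> : L * mesh n * (2 ^ n)%:R = L * (T - t).
    by rewrite natrX /mesh; field; rewrite expf_neq0.
  (* At most [2 ^ n] one-step errors accumulate, which costs one power of the mesh; since [e > 1],
     the total still tends to 0. *)
  have hk : k%:R * mesh n `^ e <= (T - t) * mesh n `^ (e - 1).
    rewrite (_ : mesh n `^ e = mesh n * mesh n `^ (e - 1)).
      by rewrite mulrA ler_wpM2r ?powR_ge0//; case/andP: (len n k k2).
    by rewrite mulr_powRB1 ?ltW// (lt_trans ltr01).
  rewrite (_ : _ * expR _ =
    2 * C * expR (K + L * (T - t)) * (k%:R * mesh n `^ e)); last by ring.
  rewrite (_ : W * _ =
    2 * C * expR (K + L * (T - t)) * ((T - t) * mesh n `^ (e - 1))); last first.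
    by rewrite /W; ring.
  by rewrite ler_wpM2l// !mulr_ge0 ?expR_ge0.
have [CX CX0 HCX] := holder_onP HX; have [CY CY0 HCY] := holder_onP HY.
move=> s sT; rewrite -subr_ge0 -oppr_le0; apply/ler_addgt0Pr => eps eps0.
have eps2 : 0 < eps / 2 by rewrite divr_gt0.
have s1 := mesh_powR_small (CX + CY) tT gamma0 eps2.
have e10 : 0 < e - 1 by rewrite subr_gt0.
have s2 := mesh_powR_small W tT e10 eps2.
have [n [[/= h1 h2] h3]] := @filter_ex _ \oo _ _ (filterI (filterI s1 s2) grid).
(* From the grid to an arbitrary time: [X] and [Y] are Hölder continuous, so both move little
   between [s] and the grid point to its left. *)
have [i i2 /andP[si1 si2]] := dyadic_floor tT n sT.
have iT := dyadic_in tT i2.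
have dX := HCX _ _ iT sT; have dY := HCY _ _ iT sT.
rewrite (ger0_norm si1) in dX dY.
have hp : (s - dyadic n i) `^ gamma <= mesh n `^ gamma.
  by rewrite ge0_ler_powR ?nnegrE ?(ltW gamma0)// ltW.
have := ler_wpM2l CX0 hp; have := ler_wpM2l CY0 hp.
have := h3 _ i2; move: dX dY; rewrite !ler_norml => /andP[? ?] /andP[? ?].
rewrite mulrDl in h1.
by lra.
Qed.

End path_comparison.

(** * Consequences of the ordering in the first grid cell *)

Section path_necessary.
Context {R : realType}.
Variables t T : R.
Hypothesis tT : t < T.
Notation mesh := (mesh t T).
Notation dyadic := (dyadic t T).
Variables (e C : R) (b1 b2 sigma1 sigma2 : R -> R -> R) (g X Y : R -> R).
Hypotheses (e1 : 1 < e) (C0 : 0 <= C).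
Hypothesis XE : forall n i, (i < 2 ^ n)%N ->
  `|X (dyadic n i.+1) - X (dyadic n i)
    - b1 (dyadic n i) (X (dyadic n i)) * mesh n
    - sigma1 (dyadic n i) (X (dyadic n i)) * (g (dyadic n i.+1) - g (dyadic n i))|
    <= C * mesh n `^ e.
Hypothesis YE : forall n i, (i < 2 ^ n)%N ->
  `|Y (dyadic n i.+1) - Y (dyadic n i)
    - b2 (dyadic n i) (Y (dyadic n i)) * mesh n
    - sigma2 (dyadic n i) (Y (dyadic n i)) * (g (dyadic n i.+1) - g (dyadic n i))|
    <= C * mesh n `^ e.
Variable z : R.
Hypotheses (Xt : X t = z) (Yt : Y t = z).
Hypothesis XY : forall s, s \in `[t, T] -> X s <= Y s.

Lemma first_step_le n :
  (sigma1 t z - sigma2 t z) * (g (dyadic n 1) - g t)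
    <= (b2 t z - b1 t z + 2 * C * mesh n `^ (e - 1)) * mesh n.
Proof.
have := XE (expn_gt0 2 n); have := YE (expn_gt0 2 n); rewrite dyadic0 Xt Yt.
have := XY (dyadic_in tT (expn_gt0 2 n)).
have hE : mesh n `^ e = mesh n * mesh n `^ (e - 1).
  by rewrite mulr_powRB1 ?(lt_trans ltr01)// ltW ?mesh_gt0.
rewrite !ler_norml hE => ? /andP[? ?] /andP[? ?].
by lra.
Qed.

Lemma drift_le_of_path_le : sigma1 t z = sigma2 t z -> b1 t z <= b2 t z.
Proof.
move=> s12; rewrite -subr_ge0 -oppr_le0; apply/ler_addgt0Pr => eps eps0.
have e10 : 0 < e - 1 by rewrite subr_gt0.
have [n /= hn] := @filter_ex _ \oo _ _ (mesh_powR_small (2 * C) tT e10 eps0).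
have := first_step_le n; rewrite s12 subrr mul0r pmulr_lge0 ?mesh_gt0//.
by lra.
Qed.

End path_necessary.

(** * Gaussian estimates *)

Section normal_estimates.
Context {R : realType}.
Implicit Types m s a x : R.
Notation mu := (@lebesgue_measure R).
Local Open Scope ereal_scope.

Lemma ge0_integral_normal_prob m s (f : measurableTypeR R -> \bar R) :
  measurable_fun setT f -> (forall x, 0 <= f x) ->
  \int[normal_prob m s]_x f x = \int[mu]_x (f x * (normal_pdf m s x)%:E).
Proof.
move=> mf f0.
have dom := normal_prob_dominates m s.
rewrite -(Radon_Nikodym_SigmaFinite.change_of_variables dom)//.
have fint := Radon_Nikodym_SigmaFinite.f_integrable dom.
apply: ae_eq_integral => //.
- by apply: emeasurable_funM => //; exact: measurable_int fint.
- apply: emeasurable_funM => //.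
  by apply/measurable_EFinP; exact: measurable_normal_pdf.
- apply: ae_eqe_mul2l; apply: integral_ae_eq => //.
  + by apply/measurable_EFinP; exact: measurable_normal_pdf.
  + by move=> E _ mE; rewrite -Radon_Nikodym_SigmaFinite.f_integral.
Qed.

(* Splitting [exp(-y^2/2s^2)] into two equal factors turns one of them into a
   normal density of variance [2s^2] and leaves the other as a gain. *)
Lemma normal_pdf_widen m s x : (0 < s)%R ->
  normal_pdf m s x = (Num.sqrt 2 * expR (- ((x - m) ^+ 2 / (4 * s ^+ 2))) *
    normal_pdf m (Num.sqrt 2 * s) x)%R.
Proof.
move=> s0; have r0 : (0 < Num.sqrt 2 :> R)%R by rewrite sqrtr_gt0.
rewrite !normal_pdfE ?gt_eqF ?mulr_gt0// /normal_peak /normal_fun.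
have -> : Num.sqrt ((Num.sqrt 2 * s) ^+ 2 * pi *+ 2) =
    (Num.sqrt 2 * Num.sqrt (s ^+ 2 * pi *+ 2))%R.
  by rewrite -sqrtrM// exprMn sqr_sqrtr//; congr Num.sqrt; ring.
have -> : (- (x - m) ^+ 2 / (s ^+ 2 *+ 2) = - ((x - m) ^+ 2 / (4 * s ^+ 2)) +
    - (x - m) ^+ 2 / ((Num.sqrt 2 * s) ^+ 2 *+ 2))%R.
  by rewrite exprMn sqr_sqrtr//; field; rewrite gt_eqF.
rewrite expRD invfM; field.
rewrite !lt0r_neq0// sqrtr_gt0 mulrn_wgt0// mulr_gt0 ?pi_gt0//.
by rewrite exprn_gt0.
Qed.

(** After [normal_pdf_widen], the gained factor is at most [expR (- (a ^ 2 / (4 * s ^ 2)))] on the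
    tail, and the widened density has mass at most 1. *)
Lemma normal_tail m s a : (0 < s)%R -> (0 <= a)%R ->
  normal_prob m s [set x | (a <= `|x - m|)%R] <=
    (Num.sqrt 2 * expR (- (a ^+ 2 / (4 * s ^+ 2))))%:E.
Proof.
move=> s0 a0.
have r0 : (0 < Num.sqrt 2 :> R)%R by rewrite sqrtr_gt0.
set D := [set x | _].
have mD : measurable D.
  rewrite [D](_ : _ = (fun x => `|x - m|)%R @^-1` `[a, +oo[).
    rewrite -[X in measurable X]setTI.
    apply: (_ : measurable_fun setT (fun x : R => `|x - m|%R)) => //.
    by apply: measurableT_comp => //; exact: measurable_funB.
  by apply/seteqP; split => x /=; rewrite in_itv/= andbT.
rewrite /normal_prob.
apply: (@le_trans _ _ (\int[mu]_(x in D) ((Num.sqrt 2 *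
    expR (- (a ^+ 2 / (4 * s ^+ 2))))%:E * (normal_pdf m (Num.sqrt 2 * s) x)%:E))).
  apply: ge0_le_integral => //.
  - by move=> x _; rewrite lee_fin normal_pdf_ge0.
  - apply/measurable_funTS/measurable_EFinP.
    exact: measurable_normal_pdf.
  - apply/measurable_funTS/emeasurable_funM => //; apply/measurable_EFinP.
    exact: measurable_normal_pdf.
  - move=> x /= ax; rewrite -EFinM lee_fin normal_pdf_widen//.
    rewrite ler_wpM2r ?normal_pdf_ge0// ler_wpM2l ?(ltW r0)// ler_expR lerN2.
    rewrite ler_wpM2r ?invr_ge0 ?mulr_ge0 ?sqr_ge0 ?(ltW s0)//.
    by rewrite -(real_normK (num_real (x - m))) lerXn2r ?nnegrE.
rewrite ge0_integralZl//=; last 2 first.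
- apply/measurable_funTS/measurable_EFinP; exact: measurable_normal_pdf.
- by move=> x _; rewrite lee_fin normal_pdf_ge0.
rewrite -[leRHS]mule1 lee_wpmul2l ?lee_fin ?mulr_ge0 ?expR_ge0 ?(ltW r0)//.
exact: (probability_le1 (normal_prob m (Num.sqrt 2 * s)) mD).
Qed.

(** The density never exceeds [1 / (2 * s)], because [pi >= 2], and the interval has length
    [2 * a]. *)
Lemma normal_prob_itv_le m s a : (0 < s)%R -> (0 <= a)%R ->
  normal_prob m s `[(- a)%R, a] <= (a / s)%:E.
Proof.
move=> s0 a0; rewrite /normal_prob.
apply: (@le_trans _ _ (\int[mu]_(x in `[(- a)%R, a]) cst (normal_peak s)%:E x)).
  apply: ge0_le_integral => //=.
  - by move=> x _; rewrite lee_fin normal_pdf_ge0.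
  - apply/measurable_funTS/measurable_EFinP; exact: measurable_normal_pdf.
  - by move=> x _; rewrite lee_fin normal_pdf_ub// gt_eqF.
rewrite integral_cst//= lebesgue_measure_itv/= lte_fin.
have peak : (normal_peak s <= (2 * s)^-1)%R.
  rewrite /normal_peak lef_pV2 ?posrE ?mulr_gt0//; last first.
    by rewrite sqrtr_gt0 mulrn_wgt0// mulr_gt0 ?pi_gt0// exprn_gt0.
  rewrite -[leLHS]gtr0_norm ?mulr_gt0// -sqrtr_sqr.
  rewrite ler_sqrt ?mulrn_wge0 ?mulr_ge0 ?sqr_ge0 ?pi_ge0 ?(ltW s0)//.
  have := ler_wpM2l (sqr_ge0 s) (@pi_ge2 R).
  by rewrite exprMn; lra.
case: ltP => _; last by rewrite mule0 lee_fin divr_ge0// ltW.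
rewrite -EFinD -EFinM lee_fin.
rewrite (le_trans (ler_wpM2r _ peak)) ?opprK ?addr_ge0//.
by rewrite le_eqVlt; apply/orP; left; apply/eqP; field; rewrite gt_eqF.
Qed.

(* The constants [3] are those of [gaussian_normal_param] below. *)
Lemma normal_pdf_lower m s a x : (0 < s)%R -> (0 < a)%R -> (a <= 3 * s)%R ->
  (`|m| <= 3 * s)%R -> (- (2 * a) <= x <= - a)%R ->
  (expR (- 41) / (4 * s) <= normal_pdf m s x)%R.
Proof.
move=> s0 a0 as3 ms /andP[xl xu].
rewrite normal_pdfE ?gt_eqF// mulrC ler_pM ?expR_ge0 ?invr_ge0 ?mulr_ge0 ?(ltW s0)//.
- rewrite /normal_peak lef_pV2 ?posrE ?mulr_gt0//; last first.
    by rewrite sqrtr_gt0 mulrn_wgt0// mulr_gt0 ?pi_gt0// exprn_gt0.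
  rewrite -[leRHS]gtr0_norm ?mulr_gt0// -sqrtr_sqr ler_sqrt ?sqr_ge0//.
  have : (pi <= 4 :> R)%R by have := @pihalf_lt2 R; lra.
  by have := sqr_ge0 s; move=> s2 /(ler_wpM2l s2); rewrite exprMn; lra.
(* Here [|x| <= 2 * a <= 6 * s] and [|m| <= 3 * s], so [|x - m| <= 9 * s] and the exponent is at
   most 81/2, which is below 41. *)
- rewrite /normal_fun ler_expR mulNr lerN2 ler_pdivrMr; last first.
    by rewrite mulrn_wgt0// exprn_gt0.
  have : (`|x - m| <= 9 * s)%R.
    rewrite (le_trans (ler_normB _ _))//.
    have : (`|x| <= 2 * a)%R by rewrite ler_norml; lra.
    lra.
  rewrite -(real_normK (num_real (x - m))) => h.
  have : (`|x - m| ^+ 2 <= (9 * s) ^+ 2)%R by rewrite lerXn2r ?nnegrE ?mulr_ge0 ?(ltW s0).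
  by have := sqr_ge0 s; lra.
Qed.

(** The density is bounded below on the interval from [- 2 * a] to [- a], whose length is at least
    [s / 3]. The result is a constant independent of all parameters. *)
Lemma normal_prob_lower m s a : (0 < s)%R -> (0 < a)%R ->
  (a <= 3 * s)%R -> (s <= 3 * a)%R -> (`|m| <= 3 * s)%R ->
  (expR (- 41) / 12)%:E <= normal_prob m s `]-oo, (- a)%R].
Proof.
move=> s0 a0 as3 sa3 ms; rewrite /normal_prob.
set I := `[(- (2 * a))%R, (- a)%R]%classic.
have IS : (I `<=` `]-oo, (- a)%R])%classic.
  by apply: subset_itvr; rewrite bnd_simp.
apply: (@le_trans _ _ (\int[mu]_(x in I) (normal_pdf m s x)%:E)); last first.
  apply: ge0_subset_integral => //=.
  - exact: measurable_itv.
  - apply/measurable_funTS/measurable_EFinP; exact: measurable_normal_pdf.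
  - by move=> x _; rewrite lee_fin normal_pdf_ge0.
apply: (@le_trans _ _ (\int[mu]_(x in I) cst (expR (- 41) / (4 * s))%:E x)).
  rewrite integral_cst//=; last exact: measurable_itv.
  rewrite lebesgue_measure_itv/= lte_fin.
  rewrite ltrN2 ltr_pMl// ltr1n -EFinD -EFinM lee_fin.
  rewrite (_ : (- a - - (2 * a) = a)%R); last by ring.
  rewrite -mulrA ler_wpM2l ?expR_ge0// invfM -mulrA.
  rewrite (_ : 12 = 4 * 3)%R ?invfM ?ler_wpM2l//; last by ring.
  by rewrite mulrC ler_pdivlMr// mulrC ler_pdivrMr// mulrC.
apply: ge0_le_integral => //=.
- exact: measurable_itv.
- by move=> x _; rewrite lee_fin divr_ge0 ?expR_ge0 ?mulr_ge0// ltW.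
- apply/measurable_funTS/measurable_EFinP; exact: measurable_normal_pdf.
by move=> x; rewrite /I/= in_itv/= lee_fin; exact: normal_pdf_lower.
Qed.

(** The factor gained by [normal_pdf_widen] absorbs the square, since [y * expR (- y) <= 1]; the
    constant is [4 * 2], with [Num.sqrt 2] bounded by 2. *)
Lemma normal_second_moment m s : (0 < s)%R ->
  \int[normal_prob m s]_x ((x - m) ^+ 2)%:E <= (8 * s ^+ 2)%:E.
Proof.
move=> s0; have r0 : (0 < Num.sqrt 2 :> R)%R by rewrite sqrtr_gt0.
rewrite ge0_integral_normal_prob; last 2 first.
- apply/measurable_EFinP; apply: measurable_funX; exact: measurable_funB.
- by move=> x; rewrite lee_fin sqr_ge0.
apply: (@le_trans _ _ (\int[mu]_x
    ((8 * s ^+ 2)%:E * (normal_pdf m (Num.sqrt 2 * s) x)%:E))).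
  apply: ge0_le_integral => //=.
  - by move=> x _; rewrite mule_ge0 ?lee_fin ?sqr_ge0 ?normal_pdf_ge0.
  - apply: emeasurable_funM; apply/measurable_EFinP; last exact: measurable_normal_pdf.
    by apply: measurable_funX; exact: measurable_funB.
  - by apply: emeasurable_funM => //; apply/measurable_EFinP; exact: measurable_normal_pdf.
  - move=> x _; rewrite -!EFinM lee_fin normal_pdf_widen// [leLHS]mulrA.
    rewrite ler_wpM2r ?normal_pdf_ge0//.
    set y := ((x - m) ^+ 2 / (4 * s ^+ 2))%R.
    have y0 : (0 <= y)%R
      by apply: divr_ge0; [exact: sqr_ge0|apply: mulr_ge0 => //; exact: sqr_ge0].
    have -> : ((x - m) ^+ 2 = 4 * s ^+ 2 * y)%R.
      by rewrite /y; field; rewrite gt_eqF.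
    have : (y * expR (- y) <= 1)%R.
      by rewrite expRN ler_pdivrMr ?expR_gt0// mul1r (le_trans _ (expR_ge1Dx _))// lerDr.
    have : (Num.sqrt 2 <= 2 :> R)%R.
      by rewrite -[leRHS]ger0_norm// -sqrtr_sqr ler_sqrt// expr2; lra.
    move=> h1 h2.
    have : (Num.sqrt 2 * (y * expR (- y)) <= 2 * 1)%R.
      exact: (ler_pM (ltW r0) (mulr_ge0 y0 (expR_ge0 _)) h1 h2).
    rewrite (_ : 4 * s ^+ 2 * y * (Num.sqrt 2 * expR (- y)) =
      4 * s ^+ 2 * (Num.sqrt 2 * (y * expR (- y))))%R; last by ring.
    move=> /(ler_wpM2l (mulr_ge0 (ler0n R 4) (sqr_ge0 s)))/le_trans; apply.
    by rewrite le_eqVlt; apply/orP; left; apply/eqP; ring.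
rewrite ge0_integralZl//=; last 3 first.
- by apply/measurable_EFinP; exact: measurable_normal_pdf.
- by move=> x _; rewrite lee_fin normal_pdf_ge0.
- by rewrite lee_fin; apply: mulr_ge0 => //; exact: sqr_ge0.
by rewrite integral_normal_pdf mule1.
Qed.

End normal_estimates.

Section gaussian_estimates.
Context {d : measure_display} {Omega : measurableType d} {R : realType}.
Variable P : probability Omega R.
Implicit Types Z : Omega -> R.
Local Open Scope ereal_scope.

Lemma centered_moment Z (sigma m : R) : Z \in Lfun P 2%:E ->
  'E_P[Z] = 0 -> 'V_P[Z] = (sigma ^+ 2)%:E ->
  \int[P]_w ((Z w - m) ^+ 2)%:E = (sigma ^+ 2 + m ^+ 2)%:E.
Proof.
move=> Z2 EZ VZ.
have Pfin : P setT \is a fin_num := fin_num_measure P _ measurableT.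
have Z1 := Lfun_subset12 Pfin Z2.
have Zm2 : (Z \- cst m)%R \in Lfun P 2%:E.
  by rewrite rpredB ?lee1n//= => _; rewrite Lfun_cst.
have := varianceE Zm2.
rewrite varianceB_cst_r// VZ expectationB ?Lfun_cst// EZ expectation_cst.
rewrite add0e -EFinN mulrNN -expr2 => H.
have -> : \int[P]_w ((Z w - m) ^+ 2)%:E = 'E_P[(Z \- cst m) ^+ 2].
  by rewrite unlock.
by rewrite EFinD H EFinN subeK.
Qed.

Lemma ge0_integral_law Z (nu : {measure set (measurableTypeR R) -> \bar R})
    (f : measurableTypeR R -> \bar R) :
  measurable_fun setT Z ->
  (forall A : set R, measurable A -> P (Z @^-1` A) = nu A) ->
  measurable_fun setT f -> (forall x, 0 <= f x) ->
  \int[nu]_x f x = \int[P]_w f (Z w).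
Proof.
move=> mZ lawZ mf f0.
have mZ' : @measurable_fun _ _ Omega (measurableTypeR R) setT Z by exact: mZ.
pose Z' : {mfun Omega >-> measurableTypeR R} :=
  @mfun_Sub _ _ Omega (measurableTypeR R) Z (mem_set mZ').
have := ge0_integral_distribution (P := P) Z' mf f0.
rewrite (_ : \int[P]_w f (Z w) = \int[P]_w (f \o Z') w)// => <-.
by apply: eq_measure_integral => A mA _; rewrite -lawZ.
Qed.

Let normK (Z : Omega -> R) (a : R) :
  [set w | (a <= `|Z w|)%R] = ~` (Z @^-1` [set x | `|x| < a]%R).
Proof. by apply/seteqP; split => w /=; rewrite leNgt => /negP. Qed.

Let measurable_norm_ge (m a : R) : measurable [set x : R | (a <= `|x - m|)%R].
Proof.
rewrite (_ : [set x | _] = (fun x => `|x - m|)%R @^-1` `[a, +oo[).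
  rewrite -[X in measurable X]setTI.
  apply: (_ : measurable_fun setT (fun x : R => `|x - m|%R)) => //.
  by apply: measurableT_comp => //; exact: measurable_funB.
by apply/seteqP; split => x /=; rewrite in_itv/= andbT.
Qed.

(* Only the order of magnitude of the parameters is needed, so the moments of
   the normal law do not have to be computed exactly. *)
Lemma gaussian_normal_param Z (sigma : R) : (0 < sigma)%R -> gaussian P Z ->
  Z \in Lfun P 2%:E -> 'E_P[Z] = 0 -> 'V_P[Z] = (sigma ^+ 2)%:E ->
  exists m s : R, [/\ (0 < s)%R, (s <= 3 * sigma)%R, (sigma <= 3 * s)%R,
    (`|m| <= 3 * s)%R &
    forall A : set R, measurable A -> P (Z @^-1` A) = normal_prob m s A].
Proof.
move=> sigma0 [mZ lawZ] Z2 EZ VZ.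
have sq (m : R) : measurable_fun setT
    (fun x : measurableTypeR R => ((x - m) ^+ 2)%:E).
  by apply/measurable_EFinP; apply: measurable_funX; exact: measurable_funB.
have sq0 (m x : R) : 0 <= ((x - m) ^+ 2)%:E by rewrite lee_fin sqr_ge0.
case: lawZ => [[m lawZ]|[m [s [s0 lawZ]]]].
  (* A point mass has zero second moment about [m], whereas that of [Z] is
     [sigma ^ 2 + m ^ 2 > 0]. *)
  have := ge0_integral_law (nu := dirac (m : measurableTypeR R)) mZ lawZ (sq m) (sq0 m).
  rewrite integral_dirac//= (centered_moment m Z2 EZ VZ) subrr expr0n/= mule0.
  move=> /esym [] /eqP; rewrite paddr_eq0 ?sqr_ge0// sqrf_eq0.
  by rewrite (gt_eqF sigma0).
exists m, s.
have := normal_second_moment m s0.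
rewrite (ge0_integral_law (nu := normal_prob m s) mZ lawZ (sq m) (sq0 m)).
rewrite (centered_moment m Z2 EZ VZ) lee_fin => hm.
have bnd (x : R) : (0 <= x)%R -> (x ^+ 2 <= 8 * s ^+ 2)%R -> (x <= 3 * s)%R.
  move=> x0 hx; rewrite -(@ler_pXn2r _ 2)// ?nnegrE ?mulr_ge0 ?(ltW s0)//.
  by rewrite exprMn; have := sqr_ge0 s; lra.
have mZ' : @measurable_fun _ _ Omega R setT Z by exact: mZ.
pose Z' : {RV P >-> R} := @mfun_Sub _ _ Omega R Z (mem_set mZ').
have s2 : (0 < 2 * sigma)%R by rewrite mulr_gt0.
(* Chebyshev at [2 * sigma] leaves probability at least 3/4 for [|Z| < 2 * sigma], while the bounded
   density allows at most [2 * sigma / s]; hence [s <= 8 / 3 * sigma]. *)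
have := chebyshev Z' s2.
rewrite (_ : (Z' : Omega -> R) = Z)// EZ VZ /= -EFinM.
rewrite (_ : (2 * sigma) ^- 2 * sigma ^+ 2 = 4^-1)%R; last first.
  by field; rewrite gt_eqF.
under [in X in X <= _ -> _]eq_set do rewrite subr0.
rewrite normK => hC.
have mI : measurable [set x : R | (`|x| < 2 * sigma)%R].
  rewrite (_ : [set x | _] = (fun x => `|x|)%R @^-1` `]-oo, (2 * sigma)%R[).
    by rewrite -[X in measurable X]setTI; apply: (_ : measurable_fun setT (fun x : R => `|x|%R)).
  by apply/seteqP; split => x /=; rewrite in_itv.
have hI : P (Z @^-1` [set x | `|x| < 2 * sigma]%R) <= (2 * sigma / s)%:E.
  rewrite lawZ// (le_trans _ (normal_prob_itv_le m s0 (ltW s2)))//.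
  apply: le_measure; rewrite ?inE//.
  move=> x /=; rewrite in_itv/= ltr_norml => /andP[? ?].
  by rewrite !ltW.
split => //.
- have mZI : measurable (Z @^-1` [set x | `|x| < 2 * sigma]%R).
    by rewrite -[X in measurable X]setTI; apply: mZ.
  have [p pE] : exists p, P (Z @^-1` [set x | `|x| < 2 * sigma]%R) = p%:E.
    exists (fine (P (Z @^-1` [set x | `|x| < 2 * sigma]%R))).
    by rewrite fineK// fin_num_measure.
  move: hI hC; rewrite (probability_setC P mZI) pE -EFinB !lee_fin.
  rewrite ler_pdivlMr// => h1 h2.
  have := ler_wpM2r (ltW s0) h2; lra.
- by apply: bnd; rewrite ?(ltW sigma0)//; have := sqr_ge0 m; lra.
- by apply: bnd => //; rewrite real_normK ?num_real//; have := sqr_ge0 sigma; lra.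
Qed.

Lemma gaussian_lower Z (sigma : R) : (0 < sigma)%R -> gaussian P Z ->
  Z \in Lfun P 2%:E -> 'E_P[Z] = 0 -> 'V_P[Z] = (sigma ^+ 2)%:E ->
  (expR (- 41) / 12)%:E <= P [set w | (Z w <= - sigma)%R].
Proof.
move=> sigma0 gZ Z2 EZ VZ.
have [m [s [s0 ssig sigs ms lawZ]]] := gaussian_normal_param sigma0 gZ Z2 EZ VZ.
rewrite (_ : [set w | _] = Z @^-1` `]-oo, (- sigma)%R]); last first.
  by apply/seteqP; split => w /=; rewrite in_itv.
rewrite lawZ; last exact: measurable_itv.
exact: normal_prob_lower.
Qed.

(** The exponential tail is weakened to a power of arbitrary order, through
    [y ^ k.+1 / k.+1! <= expR y]. The constant depends on [k] only, so it is uniform over all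
    increments of [B]. *)
Lemma gaussian_tail k : exists2 A : R, (0 <= A)%R &
  forall Z (sigma a : R), (0 < sigma)%R -> (0 < a)%R ->
  gaussian P Z -> Z \in Lfun P 2%:E -> 'E_P[Z] = 0 ->
  'V_P[Z] = (sigma ^+ 2)%:E ->
  P [set w | (a <= `|Z w|)%R] <= (A * ((sigma / a) ^+ 2) ^+ k.+1)%:E.
Proof.
(* With [324 = 18 ^ 2] the bound exceeds 1 when [a <= 18 * sigma]. Beyond that,
   [|m| <= 3 * s <= 9 * sigma < a / 2], so half of [a] is left after recentring at [m]. *)
exists (2 * k.+1`!%:R * 324 ^+ k.+1)%R.
  by apply: mulr_ge0; [exact: mulr_ge0|exact/exprn_ge0/ler0n].
move=> Z sigma a sigma0 a0 gZ Z2 EZ VZ.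
have [m [s [s0 ssig sigs ms lawZ]]] := gaussian_normal_param sigma0 gZ Z2 EZ VZ.
have mZ : measurable_fun setT Z by case: gZ.
have f1 : (1 <= k.+1`!%:R :> R)%R by rewrite ler1n fact_gt0.
set q := ((sigma / a) ^+ 2)%R.
have q0 : (0 < q)%R by rewrite exprn_gt0// divr_gt0.
have [a18|a18] := lerP a (18 * sigma).
  apply: (@le_trans _ _ 1).
    apply: probability_le1.
    rewrite (_ : [set w | _] = Z @^-1` [set x | (a <= `|x - 0|)%R]).
      by rewrite -[X in measurable X]setTI; apply: mZ => //; exact: measurable_norm_ge.
    by apply/seteqP; split => w /=; rewrite subr0.
  rewrite lee_fin -mulrA -exprMn.
  have q1 : (1 <= 324 * q)%R.
    rewrite (_ : 324 * q = (18 * sigma / a) ^+ 2)%R; last first.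
      by rewrite /q !exprMn; ring.
    by rewrite exprn_ege1// ler_pdivlMr// mul1r.
  have := exprn_ege1 k.+1 q1; move: ((324 * q) ^+ k.+1)%R => Q Q1.
  have : (1 * 1 <= k.+1`!%:R * Q)%R by rewrite ler_pM.
  by lra.
apply: (@le_trans _ _ (normal_prob m s [set x | (a / 2 <= `|x - m|)%R])).
  rewrite -lawZ; last exact: measurable_norm_ge.
  apply: le_measure; rewrite ?inE.
  - rewrite (_ : [set w | _] = Z @^-1` [set x | (a <= `|x - 0|)%R]).
      by rewrite -[X in measurable X]setTI; apply: mZ => //; exact: measurable_norm_ge.
    by apply/seteqP; split => w /=; rewrite subr0.
  - by rewrite -[X in measurable X]setTI; apply: mZ => //; exact: measurable_norm_ge.
  - move=> w /= aZ; have := ler_normD (Z w - m)%R m; rewrite subrK => h.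
    by lra.
rewrite (le_trans (normal_tail _ s0 _)) ?lee_fin ?divr_ge0 ?(ltW a0)//.
set y := ((a / 2) ^+ 2 / (4 * s ^+ 2))%R.
have yq : (1 <= y * (144 * q))%R.
  rewrite (_ : _ * _ = (3 * sigma / s) ^+ 2)%R; last first.
    by rewrite /y /q; field; rewrite !gt_eqF.
  by rewrite exprn_ege1// ler_pdivlMr// mul1r.
have y0 : (0 < y)%R by rewrite divr_gt0 ?exprn_gt0 ?divr_gt0 ?mulr_gt0 ?exprn_gt0.
have hE : (expR (- y) <= k.+1`!%:R * (144 * q) ^+ k.+1)%R.
  rewrite expRN -[leLHS]mul1r ler_pdivrMr ?expR_gt0//.
  have := expR_ge1Dxn k (ltW y0).
  have := exprn_ege1 k.+1 yq; rewrite exprMn.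
  set yk := (y ^+ k.+1)%R; set Qk := ((144 * q) ^+ k.+1)%R => h1 h2.
  have Q0 : (0 <= Qk)%R by apply/exprn_ge0/mulr_ge0 => //; exact: ltW.
  have fQ : (0 <= k.+1`!%:R * Qk)%R by rewrite mulr_ge0.
  have h3 : (yk / k.+1`!%:R <= expR y)%R by lra.
  have := ler_wpM2l fQ h3.
  rewrite (_ : _ * (_ / _) = yk * Qk)%R; last first.
    by field; rewrite pnatr_eq0 -lt0n fact_gt0.
  by lra.
have r2 : (Num.sqrt 2 <= 2 :> R)%R.
  by rewrite -[leRHS]ger0_norm// -sqrtr_sqr ler_sqrt// expr2; lra.
apply: (@le_trans _ _ (2 * (k.+1`!%:R * (144 * q) ^+ k.+1))%R).
  by rewrite ler_pM ?expR_ge0 ?sqrtr_ge0.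
rewrite [leLHS]mulrA -[leRHS]mulrA -exprMn ler_wpM2l ?mulr_ge0//.
have h144 : (144 * q <= 324 * q)%R by rewrite ler_wpM2r ?(ltW q0)//; lra.
have h0 : (0 <= 144 * q)%R by apply: mulr_ge0 => //; exact: ltW.
move: h144 h0; move: (144 * q)%R (324 * q)%R => u v uv u0.
by rewrite lerXn2r ?nnegrE// (le_trans u0).
Qed.

End gaussian_estimates.

(** * Paths of fractional Brownian motion *)

Section fBm_increments.
Context {d : measure_display} {Omega : measurableType d} {R : realType}.
Variables (P : probability Omega R) (H : R) (B : R -> Omega -> R).
Hypotheses (H_range : 2^-1 < H < 1) (B_fBm : fBm P H B).
Local Open Scope ereal_scope.

Let H0 : (0 < H)%R. Proof. by case/andP: H_range => h _; lra. Qed.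

Lemma fBm_measurable s : (0 <= s)%R -> measurable_fun setT (B s).
Proof.
move=> s0; have [gp _ _ _] := B_fBm.
have [+ _] := gp 1%N (fun=> s) (fun=> 1%R) (fun=> s0).
by congr measurable_fun; apply/funext => w; rewrite big_ord1 mul1r.
Qed.

Lemma Lfun2_of_sqr (f : Omega -> R) : measurable_fun setT f ->
  \int[P]_w ((f w) ^+ 2)%:E < +oo -> f \in Lfun P 2%:E.
Proof.
move=> mf foo; apply/andP; split; first by rewrite inE.
rewrite !inE/= /finite_norm unlock poweR_lty//.
by under eq_integral do rewrite /= powR_mulrn// real_normK ?num_real//.
Qed.

(** The covariance formula at equal times says that the integral of the square is a finite number,
    the mean being zero. *)
Lemma fBm_Lfun2 s : (0 <= s)%R -> B s \in Lfun P 2%:E.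
Proof.
move=> s0; have [_ mB cB _] := B_fBm.
apply: Lfun2_of_sqr; first exact: fBm_measurable.
have := cB s s s0 s0; rewrite covariance.unlock mB//= expectation.unlock.
rewrite (_ : (_ * _)%R = (fun w => B s w ^+ 2)%R); last first.
  by apply/funext => w; rewrite !fctE/= subr0 expr2.
by move=> ->; exact: ltry.
Qed.

Variables s t : R.
Hypotheses (s0 : (0 <= s)%R) (t0 : (0 <= t)%R).

Lemma gaussian_increment : gaussian P (B t \- B s)%R.
Proof.
have [gp _ _ _] := B_fBm.
have := gp 2%N (fun i => if i == ord0 then t else s)
  (fun i => if i == ord0 then 1 else - 1)%R.
move=> /(_ _)/wrap[]; first by move=> i; case: ifP.
by congr gaussian; apply/funext => w; rewrite big_ord_recl big_ord1/=; ring.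
Qed.

Lemma increment_Lfun2 : (B t \- B s)%R \in Lfun P 2%:E.
Proof.
have := fBm_Lfun2 s0; have := fBm_Lfun2 t0 => ht hs.
by rewrite rpredB ?lee1n//=.
Qed.

Lemma increment_mean : 'E_P[(B t \- B s)%R] = 0.
Proof.
have [_ mB _ _] := B_fBm.
have Pfin : P setT \is a fin_num := fin_num_measure P _ measurableT.
have l1 u : (0 <= u)%R -> B u \in Lfun P 1.
  by move=> u0; exact: (Lfun_subset12 Pfin (fBm_Lfun2 u0)).
by rewrite expectationB ?l1// !mB// sube0.
Qed.

Lemma increment_variance : 'V_P[(B t \- B s)%R] = ((`|t - s| `^ H) ^+ 2)%:E.
Proof.
have [_ _ cB _] := B_fBm.
rewrite varianceB ?fBm_Lfun2// /variance !cB//.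
rewrite -(EFinM 2) -[X in X - _]EFinD -EFinB !subrr normr0.
rewrite powR0 ?mulf_neq0 ?gt_eqF// distrC -powR_mulrn ?powR_ge0// -powRrM.
rewrite [(H * _)%R]mulrC; congr EFin.
by field.
Qed.

End fBm_increments.

(* Rounding both endpoints inward to the coarser grid costs two increments of
   size [mesh ^ kappa]; the correction term [D * mesh ^ kappa] absorbs them. *)
Lemma dyadic_chaining {R : realType} (t T kappa K : R) (g : R -> R) :
  t < T -> 0 < kappa -> 0 <= K ->
  (forall n i, (i < 2 ^ n)%N ->
    `|g (dyadic t T n i.+1) - g (dyadic t T n i)| <= K * mesh t T n `^ kappa) ->
  holder_dyadic_on t T kappa g.
Proof.
move=> tT k0 K0 HK.
(* [r] is the ratio of [mesh ^ kappa] between consecutive levels, and [D] solves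
   [D * r = D + 2 * K]: the correction at the coarser level pays for the two end increments. *)
pose r : R := 2 `^ kappa; pose D := 2 * K / (r - 1).
have r1 : 0 < r - 1.
  rewrite subr_gt0 /r /powR pnatr_eq0/= -[ltLHS]expR0 ltr_expR.
  by rewrite mulr_gt0// ln_gt0// ltr1n.
have D0 : 0 <= D by rewrite divr_ge0 ?mulr_ge0// ltW.
have Dr : D * r = D + 2 * K by rewrite /D; field; rewrite gt_eqF.
have h0 n : 0 <= mesh t T n by exact/ltW/mesh_gt0.
have mh a n : 0 <= a%:R * mesh t T n by apply: mulr_ge0.
have rM x : 0 <= x -> r * x `^ kappa = (2 * x) `^ kappa by move=> x0; rewrite powRM.
have hr n : mesh t T n `^ kappa = r * mesh t T n.+1 `^ kappa.
  by rewrite rM// (mesh2 t T n 1) expr1 addn1.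
clearbody r D.
have key n : forall i j, (i < j <= 2 ^ n)%N ->
    `|g (dyadic t T n j) - g (dyadic t T n i)| <=
    (D + K) * ((j - i)%:R * mesh t T n) `^ kappa - D * mesh t T n `^ kappa.
  elim: n => [|n IHn] i j /andP[ij jn].
    have -> : j = i.+1 by move: ij jn; rewrite expn0; lia.
    rewrite subSnn mul1r mulrDl addrAC subrr add0r HK//.
    exact: leq_trans jn.
  set h := mesh t T n.+1 `^ kappa.
  have hh0 : 0 <= h by exact: powR_ge0.
  have [j1|j2] := leqP j i.+1.
    have -> : j = i.+1 by lia.
    rewrite subSnn mul1r mulrDl addrAC subrr add0r HK//.
    exact: leq_trans jn.
  have [i' [j' [i1 i2 j1' j2' ij']]] : exists i' j' : nat,
      [/\ (i <= i' * 2)%N, (i' * 2 <= i.+1)%N, (j' * 2 <= j)%N,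
          (j <= (j' * 2).+1)%N & (i' <= j')%N].
    by exists (uphalf i), j./2; split; lia.
  have jn' : (j' <= 2 ^ n)%N by rewrite expnS in jn; lia.
  have near2 a b : (a <= b)%N -> (b <= a.+1)%N -> (b <= 2 ^ n.+1)%N ->
      `|g (dyadic t T n.+1 b) - g (dyadic t T n.+1 a)| <= K * h.
    move=> ab ba bn; have [<-|ab'] := eqVneq a b.
      by rewrite subrr normr0 mulr_ge0.
    have bE : b = a.+1 by lia.
    by rewrite bE HK// -bE.
  have e1 := near2 _ _ j1' j2' jn.
  have e2 : `|g (dyadic t T n.+1 (i' * 2)) - g (dyadic t T n.+1 i)| <= K * h.
    by apply: near2 => //; lia.
  have fine k : dyadic t T n.+1 (k * 2) = dyadic t T n k.
    by rewrite (dyadic_refine t T n 1) addn1 expn1.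
  rewrite !fine in e1 e2.
  have h2 : r * h <= ((j - i)%:R * mesh t T n.+1) `^ kappa.
    rewrite /h rM// ge0_ler_powR ?nnegrE ?mh ?(ltW k0)//.
    by rewrite ler_wpM2r// ler_nat; lia.
  have mid : `|g (dyadic t T n j') - g (dyadic t T n i')| <=
      (D + K) * ((j - i)%:R * mesh t T n.+1) `^ kappa - D * h - 2 * (K * h).
    (* When the rounded interval collapses to a point, the induction hypothesis says nothing;
       [j - i >= 2], in the form [h2], gives the bound instead. *)
    have [->|ij''] := eqVneq i' j'.
      rewrite subrr normr0.
      have := ler_wpM2l (addr_ge0 D0 K0) h2.
      have := congr1 (fun u => u * h) Dr => /=.
      have : 0 <= K * h by exact: mulr_ge0.
      have : K * h <= K * (r * h).
        by rewrite ler_wpM2l// ler_peMl// -subr_ge0 ltW.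
      by move: (_ `^ kappa) => X *; lra.
    rewrite (le_trans (IHn i' j' _))//; first by rewrite jn'; lia.
    rewrite hr -/h.
    have := congr1 (fun u => u * h) Dr => /=.
    have : (D + K) * ((j' - i')%:R * mesh t T n) `^ kappa <=
        (D + K) * ((j - i)%:R * mesh t T n.+1) `^ kappa.
      rewrite ler_wpM2l ?addr_ge0// ge0_ler_powR ?nnegrE ?mh ?(ltW k0)//.
      rewrite (mesh2 t T n 1) expr1 addn1 mulrA ler_wpM2r// -natrM ler_nat.
      by lia.
    by move: (((j - i)%:R * _) `^ _) (((j' - i')%:R * _) `^ _) => X X' *; lra.
  move: e1 e2 mid; rewrite !ler_norml => /andP[? ?] /andP[? ?] /andP[? ?].
  by apply/andP; split; lra.
exists (D + K); first exact: addr_ge0.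
move=> n i j /andP[ij jn]; have [->|ij'] := eqVneq i j.
  by rewrite subrr normr0 mulr_ge0 ?addr_ge0 ?powR_ge0.
rewrite (le_trans (key n i j _)) ?jn ?andbT//; first by lia.
by rewrite gerBl mulr_ge0 ?powR_ge0.
Qed.

(** Each tail union contains some [F n], and the tail unions decrease to the limit superior, so
    continuity from above suffices. No independence is involved, which matters for the correlated
    increments of [B]. *)
Lemma lim_sup_set_ge {d} {T : measurableType d} {R : realType}
    (P : probability T R) (F : (set T)^nat) (p : \bar R) :
  (forall n, measurable (F n)) -> (forall n, (p <= P (F n))%E) ->
  (p <= P (lim_sup_set F))%E.
Proof.
move=> mF pF.
have mU n : measurable (\bigcup_(k >= n) F k) by exact: bigcup_measurable.
have cvgF : P (\bigcup_(k >= n) F k) @[n --> \oo] --> P (lim_sup_set F).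
  apply: lim_sup_set_cvg => //.
  by rewrite (le_lt_trans (probability_le1 P (mU 0%N)))// ltry.
rewrite -(cvg_lim (@ereal_hausdorff R) cvgF); apply: lime_ge.
  by apply/cvg_ex; exists (P (lim_sup_set F)).
apply: nearW => n; rewrite (le_trans (pF n))// le_measure ?inE//.
by move=> x Fx; exists n => /=.
Qed.

(** * Almost sure regularity and roughness of the paths *)

Section fBm_paths.
Context {d : measure_display} {Omega : measurableType d} {R : realType}.
Variables (P : probability Omega R) (H : R) (B : R -> Omega -> R).
Hypotheses (H_range : 2^-1 < H < 1) (B_fBm : fBm P H B).
Variables t T : R.
Hypotheses (t0 : 0 <= t) (tT : t < T).
Notation mesh := (mesh t T).
Notation dyadic := (dyadic t T).

Let dyadic_ge0 n i : 0 <= dyadic n i.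
Proof. by rewrite /dyadic addr_ge0// mulr_ge0// ltW// mesh_gt0. Qed.

Lemma fBm_holder_dyadic kappa : 0 < kappa < H ->
  \forall w \ae P, holder_dyadic_on t T kappa (B ^~ w).
Proof.
move=> /andP[k0 kH].
pose Z n i := (B (dyadic n i.+1) \- B (dyadic n i))%R.
pose E n i := [set w | mesh n `^ kappa <= `|Z n i w|].
have mZ n i : measurable_fun setT (Z n i).
  by apply: measurable_funB; apply: (fBm_measurable B_fBm).
have mE n i : measurable (E n i).
  rewrite (_ : E n i = (fun w => `|Z n i w|) @^-1` `[mesh n `^ kappa, +oo[).
    rewrite -[X in measurable X]setTI.
    apply: (_ : measurable_fun setT (fun w => `|Z n i w|)) => //.
    exact: measurableT_comp.
  by apply/seteqP; split => w /=; rewrite in_itv/= andbT.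
pose F n := \big[setU/set0]_(i < 2 ^ n) E n i.
have mF n : measurable (F n) by apply: bigsetU_measurable.
(* With this order in [gaussian_tail], one increment is large with probability of order [mesh ^ 2],
   that is [4 ^ (- n)], which is summable against the [2 ^ n] cells of level [n]. *)
have [k kk] : exists k : nat, 2 <= 2 * k.+1%:R * (H - kappa).
  have Hk : 0 < H - kappa by rewrite subr_gt0.
  exists (Num.truncn (H - kappa)^-1).
  rewrite -mulrA -[leLHS]mulr1 ler_wpM2l// -ler_pdivrMr// mul1r.
  have := @truncn_itv _ (H - kappa)^-1; rewrite invr_ge0 (ltW Hk).
  by move=> /(_ isT)/andP[_ /ltW].
set p := 2 * k.+1%:R * (H - kappa) in kk.
have [A A0 HA] := gaussian_tail P k.
pose K := A * ((T - t) `^ (p - 2) * (T - t) ^+ 2).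
have K0 : 0 <= K.
  by rewrite mulr_ge0// mulr_ge0 ?powR_ge0 ?sqr_ge0.
have PF n : (P (F n) <= ((2 * K) / (2 ^ n.+1)%:R)%:E)%E.
  apply: le_trans; first exact: Boole_inequality.
  have h0 : 0 < mesh n by exact: mesh_gt0.
  have PE i : (P (E n i) <= (K / 4 ^+ n)%:E)%E.
    have dn : `|dyadic n i.+1 - dyadic n i| = mesh n.
      by rewrite dyadicS gtr0_norm.
    have s0 : 0 < mesh n `^ H by rewrite powR_gt0.
    have a0 : 0 < mesh n `^ kappa by rewrite powR_gt0.
    have := increment_variance H_range B_fBm (dyadic_ge0 n i) (dyadic_ge0 n i.+1).
    rewrite dn => hv.
    rewrite (le_trans (HA _ _ _ s0 a0
      (gaussian_increment B_fBm (dyadic_ge0 n i) (dyadic_ge0 n i.+1))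
      (increment_Lfun2 B_fBm (dyadic_ge0 n i) (dyadic_ge0 n i.+1))
      (increment_mean B_fBm (dyadic_ge0 n i) (dyadic_ge0 n i.+1)) hv))//.
    rewrite lee_fin /K -mulrA ler_wpM2l// -mulrA.
    rewrite -exprM -powRB; last by rewrite (gt_eqF h0) implybT.
    rewrite -powR_mulrn ?powR_ge0// -powRrM.
    rewrite (_ : (H - kappa) * _ = p); last by rewrite /p natrM; ring.
    have -> : (T - t) ^+ 2 / 4 ^+ n = mesh n `^ 2.
      rewrite powR_mulrn ?(ltW h0)// /mesh expr_div_n; congr (_ / _).
      by rewrite -exprM mulnC exprM expr2 -natrM.
    apply: ler_powR_base; first by rewrite (ltW h0) mesh_le.
    by rewrite kk ltr0n.
  apply: (@le_trans _ _ (\sum_(i < 2 ^ n) (K / 4 ^+ n)%:E)%E).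
    by apply: lee_sum => i _; exact: PE.
  rewrite sumEFin lee_fin sumr_const card_ord -[leLHS]mulr_natr natrX natrX.
  rewrite le_eqVlt; apply/orP; left; apply/eqP.
  rewrite exprS (_ : 4 = 2 * 2 :> R); last by ring.
  by rewrite exprMn; field; rewrite expf_neq0.
have sumF : (\sum_(n <oo) P (F n) < +oo)%E.
  apply: (@le_lt_trans _ _ (\sum_(n <oo) (0 + ((2 * K) / (2 ^ n.+1)%:R)%:E))%E).
    by apply: lee_nneseries => // n _; rewrite add0e.
  apply: le_lt_trans; first by apply: epsilon_trick => //; rewrite mulr_ge0.
  by rewrite eseries0// add0e ltry.
have PL := lim_sup_set_cvg0 mF sumF.
exists (lim_sup_set F); split => //.
  by apply: bigcap_measurable => // n _; exact: bigcup_measurable.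
move=> w /= hw; apply: contrapT => nL; apply: hw.
have [n0 Hn0] : exists n0, forall n, (n0 <= n)%N -> ~ F n w.
  apply: contrapT => nex; apply: nL => n _; apply: contrapT => nU; apply: nex.
  by exists n => m nm Fm; apply: nU; exists m.
(* From level [n0] on, the constant 1 is enough; the finitely many ratios of the coarser levels are
   simply added. *)
pose M := 1 + \sum_(n < n0) \sum_(i < 2 ^ n) `|Z n i w| / mesh n `^ kappa.
have t_ge0 n i : 0 <= `|Z n i w| / mesh n `^ kappa by rewrite divr_ge0 ?powR_ge0.
apply: (@dyadic_chaining _ t T kappa M) => //.
  by rewrite addr_ge0// sumr_ge0// => n _; apply: sumr_ge0.
move=> n i i2; rewrite -[leLHS]/(`|Z n i w|).
have a0 : 0 < mesh n `^ kappa by rewrite powR_gt0// mesh_gt0.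
rewrite -ler_pdivrMr//; have [nn0|n0n] := ltnP n n0.
  rewrite /M (bigD1 (Ordinal nn0))//= (bigD1 (Ordinal i2))//=.
  rewrite addrCA -addrA lerDl addr_ge0//; last first.
    by rewrite addr_ge0// sumr_ge0// => *; apply: sumr_ge0.
  by rewrite sumr_ge0.
apply: (@le_trans _ _ 1); last first.
  by rewrite /M lerDl sumr_ge0// => *; apply: sumr_ge0.
rewrite ler_pdivrMr// mul1r leNgt; apply/negP => /ltW hE.
by apply: (Hn0 n n0n); rewrite /F -bigcup_mkord; exists i.
Qed.

(** With probability bounded below in [n], the increment times [c] is at least [|c| * mesh ^ H], so
    with positive probability this occurs for infinitely many [n]. Together with the upper bound
    [C * mesh] it contradicts [mesh ^ (1 - H)] tending to 0. *)
Lemma not_ae_first_step_le (c : R) : c != 0 ->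
  ~ (\forall w \ae P, exists C : R, forall n,
       c * (B (dyadic n 1) w - B t w) <= C * mesh n).
Proof.
move=> c0 Hae.
(* [Z] is the increment with its sign turned against that of [c], so that the one half-line of
   [gaussian_lower] covers both cases. *)
have [Z [gZ mZ cZ]] : exists Z : nat -> Omega -> R,
  [/\ forall n, ((expR (- 41) / 12)%:E <=
        P [set w | (Z n w <= - (mesh n `^ H))%R])%E,
      forall n, measurable_fun setT (Z n) &
      forall n w, c * (B (dyadic n 1) w - B t w) = - (`|c| * Z n w)].
  have s0 n : 0 < mesh n `^ H by rewrite powR_gt0// mesh_gt0.
  have dn n : `|dyadic n 1 - t| = mesh n.
    by rewrite -[t in _ - t](dyadic0 t T n) dyadicS gtr0_norm ?mesh_gt0.
  have [cp|cn] := ltP 0 c.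
    exists (fun n => B t \- B (dyadic n 1)); split.
    - move=> n; have := increment_variance H_range B_fBm (dyadic_ge0 n 1) t0.
      rewrite distrC dn; apply: gaussian_lower => //.
      + exact: (gaussian_increment B_fBm).
      + exact: (increment_Lfun2 B_fBm).
      + exact: (increment_mean B_fBm).
    - by move=> n; apply: measurable_funB; apply: (fBm_measurable B_fBm).
    - by move=> n w /=; rewrite gtr0_norm//; ring.
  have cn' : c < 0 by rewrite lt_neqAle c0.
  exists (fun n => B (dyadic n 1) \- B t); split.
  - move=> n; have := increment_variance H_range B_fBm t0 (dyadic_ge0 n 1).
    rewrite dn; apply: gaussian_lower => //.
    + exact: (gaussian_increment B_fBm).
    + exact: (increment_Lfun2 B_fBm).
    + exact: (increment_mean B_fBm).
  - by move=> n; apply: measurable_funB; apply: (fBm_measurable B_fBm).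
  - by move=> n w /=; rewrite ltr0_norm//; ring.
pose F n := [set w | (Z n w <= - (mesh n `^ H))%R].
have mF n : measurable (F n).
  rewrite (_ : F n = Z n @^-1` `]-oo, - (mesh n `^ H)]).
    by rewrite -[X in measurable X]setTI; apply: mZ.
  by apply/seteqP; split => w /=; rewrite in_itv.
have := lim_sup_set_ge mF gZ.
suff -> : P (lim_sup_set F) = 0%E.
  by rewrite lee_fin leNgt divr_gt0 ?expR_gt0.
have [N [mN PN subN]] := Hae.
apply/eqP; rewrite eq_le measure_ge0 andbT -PN le_measure ?inE//.
  by apply: bigcap_measurable => // n _; exact: bigcup_measurable.
move=> w Lw; apply: subN => /= -[C HC].
have H1 : 0 < 1 - H by case/andP: H_range => _; rewrite subr_gt0.
have c1 : 0 < `|c| by rewrite normr_gt0.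
have [n1 _ Hn1] := mesh_powR_small C tT H1 c1.
have [n /= n1n Fn] := Lw n1 I.
have h0 : 0 < mesh n by exact: mesh_gt0.
have := HC n; rewrite cZ; have := Hn1 n n1n => /=.
rewrite -(ltr_pM2r (powR_gt0 H h0)) -mulrA -powRD; last first.
  by rewrite (gt_eqF h0) implybT.
rewrite subrK powRr1 ?(ltW h0)// => h1 h2.
have := ler_wpM2l (ltW c1) Fn; rewrite mulrN => h3.
by have := lt_le_trans h1 (le_trans (_ : _ <= - (`|c| * Z n w)) h2); lra.
Qed.

End fBm_paths.

(** * The comparison theorem *)

(** A solution started at [T] carries no information on the coefficients, so at [T] the conclusions
    are obtained as limits from the left. *)
Lemma le_at_right_end {R : realType} (T p K : R) (f g : R -> R) :
  0 < T -> 0 < p ->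
  (forall s, s \in `[0, T] -> `|f T - f s| <= K * `|T - s| `^ p) ->
  (forall s, s \in `[0, T] -> `|g T - g s| <= K * `|T - s| `^ p) ->
  (forall s, s \in `[0, T] -> s < T -> f s <= g s) -> f T <= g T.
Proof.
move=> T0 p0 Hf Hg fg; apply/ler_addgt0Pr => eps eps0.
have [n /= hn] := @filter_ex _ \oo _ _ (mesh_powR_small (2 * K) T0 p0 eps0).
have h0 := mesh_gt0 T0 n; have hT := mesh_le T0 n; rewrite subr0 in hT.
have sT : T - mesh 0 T n \in `[0, T].
  by rewrite in_itv/= subr_ge0 hT gerBl ltW.
have := Hf _ sT; have := Hg _ sT; rewrite subKr (gtr0_norm h0).
have := fg _ sT; rewrite gtrBl h0 => /(_ isT).
by rewrite !ler_norml => ? /andP[? ?] /andP[? ?]; lra.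
Qed.

(** The three terms of [alpha0] correspond to the last three inequalities; in particular
    [alpha < delta / (1 + delta)] means [(1 + delta) * (1 - alpha) > 1]. The conditions on [beta],
    [delta] and [H] say that [1 - H < alpha0], and [alpha] is the midpoint. *)
Lemma exists_holder_exponent {R : realType} (H beta delta : R) :
  2^-1 < H < 1 -> 0 < delta -> 1 - H < beta -> H^-1 - 1 < delta ->
  exists2 alpha : R, 1 - H < alpha < alpha0 beta delta &
    [/\ 0 < 1 - alpha < H, 1 < beta + (1 - alpha),
        1 < (1 - alpha) + (1 - alpha) & 1 < delta * (1 - alpha) + (1 - alpha)].
Proof.
move=> /andP[H2 H1] d0 bH dH.
have H0 : 0 < H by lra.
have a0H : 1 - H < alpha0 beta delta.
  rewrite /alpha0 !lt_min bH/=; apply/andP; split; first by lra.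
  rewrite ltr_pdivlMr; last by lra.
  move: dH; rewrite ltrBlDr -(ltr_pM2r H0) mulVf ?gt_eqF//; lra.
pose alpha := (1 - H + alpha0 beta delta) / 2.
have [aH aa] : 1 - H < alpha /\ alpha < alpha0 beta delta.
  by rewrite /alpha; split; lra.
have : alpha < alpha0 beta delta by [].
rewrite /alpha0 !lt_min => /and3P[a2 ab ad].
exists alpha; first by rewrite aH aa.
rewrite ltr_pdivlMr in ad; last by lra.
by split; [apply/andP; split; lra|lra|lra|lra].
Qed.

Section equations.
Context {d : measure_display} {Omega : measurableType d} {R : realType}.
Variables (P : probability Omega R) (T H : R).
Hypotheses (T_gt0 : 0 < T) (H_range : 2^-1 < H < 1).
Variable B : R -> Omega -> R.
Hypothesis B_fBm : fBm P H B.
Variables beta delta mu : R.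
Hypotheses (beta_gt : 1 - H < beta) (delta_gt : H^-1 - 1 < delta).
Variables b1 b2 sigma1 sigma2 : R -> R -> R.
Hypotheses (sigma1_H1 : hyp_H1 T beta delta sigma1)
  (b1_H2 : hyp_H2 T beta delta mu b1) (sigma2_H1 : hyp_H1 T beta delta sigma2)
  (b2_H2 : hyp_H2 T beta delta mu b2).
Variables X Y : R -> R -> R -> Omega -> R.
Hypothesis X_sol : forall t x : R, t \in `[0, T] ->
  is_solution P H T beta delta B b1 sigma1 t x (X t x).
Hypothesis Y_sol : forall t y : R, t \in `[0, T] ->
  is_solution P H T beta delta B b2 sigma2 t y (Y t y).

(** Collects every probabilistic input on one almost sure event. The exponent [gamma] is
    deterministic, while [C] depends on the path; what follows is an argument path by path. *)
Let ae_paths t x y : 0 <= t -> t < T -> exists gamma : R,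
  [/\ 0 < gamma, 1 < beta + gamma, 1 < gamma + gamma,
      1 < delta * gamma + gamma &
  \forall w \ae P,
  [/\ holder_dyadic_on t T gamma (B ^~ w),
      holder_on t T gamma (fun s => X t x s w),
      holder_on t T gamma (fun s => Y t y s w),
      X t x t w = x /\ Y t y t w = y &
      exists2 C : R, 0 <= C & forall n i, (i < 2 ^ n)%N ->
        let p := dyadic t T n i in let q := dyadic t T n i.+1 in
        `|X t x q w - X t x p w - b1 p (X t x p w) * mesh t T n
          - sigma1 p (X t x p w) * (B q w - B p w)|
          <= C * mesh t T n `^ step_order beta gamma mu /\
        `|Y t y q w - Y t y p w - b2 p (Y t y p w) * mesh t T n
          - sigma2 p (Y t y p w) * (B q w - B p w)|
          <= C * mesh t T n `^ step_order beta gamma mu]].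
Proof.
move=> t0 tT; have [_ /andP[d0 _] _ _ _] := sigma1_H1.
have [alpha aI [gH bg gg dg]] := exists_holder_exponent H_range d0 beta_gt delta_gt.
have g0 : 0 < 1 - alpha by case/andP: gH.
have tI : t \in `[0, T] by rewrite in_itv/= t0 ltW.
have [_ /(_ _ aI) XH XE] := X_sol x tI; have [_ /(_ _ aI) YH YE] := Y_sol y tI.
have BH := fBm_holder_dyadic H_range B_fBm t0 tT gH.
exists (1 - alpha); split => //.
apply: filterS3 (filterI XH YH) (filterI XE YE) BH => w [[_ HX] [_ HY]] [EX EY] HB.
split => //.
  by split; [exact: (path_start (ltW tT) EX)|exact: (path_start (ltW tT) EY)].
have [C1 C10 H1] := path_expansion t0 tT g0 bg gg sigma1_H1 b1_H2 HB HX EX.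
have [C2 C20 H2] := path_expansion t0 tT g0 bg gg sigma2_H1 b2_H2 HB HY EY.
exists (C1 + C2); first exact: addr_ge0.
move=> n i i2; split.
  by rewrite (le_trans (H1 n i i2))// ler_wpM2r ?powR_ge0// lerDl.
by rewrite (le_trans (H2 n i i2))// ler_wpM2r ?powR_ge0// lerDr.
Qed.

Lemma comparison_sufficient :
  (forall t z, t \in `[0, T] -> b1 t z <= b2 t z /\ sigma1 t z = sigma2 t z) ->
  forall t x y, t \in `[0, T] -> x <= y ->
  \forall w \ae P, forall s, s \in `[t, T] -> X t x s w <= Y t y s w.
Proof.
move=> bs t x y tI xy.
have /andP[t0 tT] : 0 <= t <= T by move: tI; rewrite in_itv.
have [tT'|Tt] := ltP t T; last first.
  (* For [t = T] the interval is a single point and the claim is the ordering of the initial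
     values. *)
  have tE : t = T by apply/eqP; rewrite eq_le tT Tt.
  have [_ _ XE] := X_sol x tI; have [_ _ YE] := Y_sol y tI.
  apply: filterS2 XE YE => w EX EY s; rewrite -{1}tE in_itv/= -eq_le => /eqP <-.
  by rewrite (path_start tT EX) (path_start tT EY).
have [gamma [g0 bg gg dg paths]] := ae_paths x y t0 tT'.
apply: filterS paths => w [HB HX HY [Xt Yt] [C C0 HC]].
apply: (path_comparison t0 tT' g0 bg gg dg HB HX HY b1_H2 C0
  (b2 := b2) (sigma1 := sigma1) (sigma2 := sigma2)) => //.
- by move=> n i i2; have [] := HC n i i2.
- by move=> n i i2; have [] := HC n i i2.
- by rewrite Xt Yt.
Qed.

Lemma comparison_necessary :
  (forall t x y, t \in `[0, T] -> x <= y ->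
    \forall w \ae P, forall s, s \in `[t, T] -> X t x s w <= Y t y s w) ->
  forall t z, t \in `[0, T] -> b1 t z <= b2 t z /\ sigma1 t z = sigma2 t z.
Proof.
move=> XY.
have main t z : 0 <= t -> t < T -> b1 t z <= b2 t z /\ sigma1 t z = sigma2 t z.
  move=> t0 tT; have tI : t \in `[0, T] by rewrite in_itv/= t0 ltW.
  have [gamma [g0 bg gg dg paths]] := ae_paths z z t0 tT.
  have e1 : 1 < step_order beta gamma mu.
    by apply: step_order_gt1 => //; exact: hyp_H2_mu_gt0 b1_H2.
  have sE : sigma1 t z = sigma2 t z.
    apply/eqP; rewrite -subr_eq0; apply: contrapT => /negP c0.
    apply: (not_ae_first_step_le H_range B_fBm t0 tT c0).
    apply: filterS2 paths (XY t z z tI (lexx _)).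
    move=> w [_ _ _ [Xt Yt] [C C0 HC]] XYw.
    exists (`|b2 t z - b1 t z| +
      2 * C * (T - t) `^ (step_order beta gamma mu - 1)) => n.
    have h0 := mesh_gt0 tT n.
    have /le_trans := first_step_le (b1 := b1) (b2 := b2) (sigma1 := sigma1)
      (sigma2 := sigma2) (g := B ^~ w) (X := X t z ^~ w) (Y := Y t z ^~ w)
      tT e1 (fun n i i2 => (HC n i i2).1) (fun n i i2 => (HC n i i2).2) Xt Yt XYw n.
    apply.
    rewrite ler_wpM2r ?(ltW h0)// lerD ?ler_norm// ler_wpM2l ?mulr_ge0//.
    rewrite ge0_ler_powR ?nnegrE ?subr_ge0 ?(ltW e1) ?(ltW h0) ?(ltW tT)//.
    exact: mesh_le.
  split => //; rewrite leNgt; apply/negP => b21.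
  (* Under [b21], every path of an almost sure event is contradictory, so every almost sure
     statement follows, including the one refuted here. The coefficient 1 is an arbitrary nonzero
     choice. *)
  apply: (not_ae_first_step_le H_range B_fBm t0 tT (oner_neq0 R)).
  apply: filterS2 paths (XY t z z tI (lexx _)).
  move=> w [_ _ _ [Xt Yt] [C C0 HC]] XYw.
  have := drift_le_of_path_le (b1 := b1) (b2 := b2) (sigma1 := sigma1)
    (sigma2 := sigma2) (g := B ^~ w) (X := X t z ^~ w) (Y := Y t z ^~ w)
    tT e1 (fun n i i2 => (HC n i i2).1) (fun n i i2 => (HC n i i2).2) Xt Yt XYw sE.
  by rewrite leNgt b21.
move=> t z; rewrite in_itv/= => /andP[t0]; rewrite le_eqVlt => /predU1P[->|]; last exact: main.
have lt0 s : s \in `[0, T] -> 0 <= s by rewrite in_itv/= => /andP[].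
have TI : T \in `[0, T] by rewrite in_itv/= lexx ltW.
have s1H : exists K, forall s, s \in `[0, T] ->
    `|sigma1 T z - sigma1 s z| <= K * `|T - s| `^ beta.
  have [_ _ _ [M M0 HM] _] := sigma1_H1; exists M => s sT.
  by have := HM _ _ z z sT TI; rewrite subrr normr0 addr0.
have s2H : exists K, forall s, s \in `[0, T] ->
    `|sigma2 T z - sigma2 s z| <= K * `|T - s| `^ beta.
  have [_ _ _ [M M0 HM] _] := sigma2_H1; exists M => s sT.
  by have := HM _ _ z z sT TI; rewrite subrr normr0 addr0.
have b1H : exists K, forall s, s \in `[0, T] ->
    `|b1 T z - b1 s z| <= K * `|T - s| `^ mu.
  have [_ /(_ `|z| (normr_ge0 z))[M M0 HM] _] := b1_H2; exists M => s sT.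
  by have := HM _ _ z z sT TI (lexx _) (lexx _); rewrite subrr normr0 addr0.
have b2H : exists K, forall s, s \in `[0, T] ->
    `|b2 T z - b2 s z| <= K * `|T - s| `^ mu.
  have [_ /(_ `|z| (normr_ge0 z))[M M0 HM] _] := b2_H2; exists M => s sT.
  by have := HM _ _ z z sT TI (lexx _) (lexx _); rewrite subrr normr0 addr0.
have end_le (f g : R -> R) (p : R) : 0 < p ->
    (exists K, forall s, s \in `[0, T] -> `|f T - f s| <= K * `|T - s| `^ p) ->
    (exists K, forall s, s \in `[0, T] -> `|g T - g s| <= K * `|T - s| `^ p) ->
    (forall s, s \in `[0, T] -> s < T -> f s <= g s) -> f T <= g T.
  move=> p0 [K1 HK1] [K2 HK2]; apply: (@le_at_right_end _ T p (`|K1| + `|K2|)) => //.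
    move=> s sT; rewrite (le_trans (HK1 s sT))// ler_wpM2r ?powR_ge0//.
    by rewrite (le_trans (ler_norm _))// lerDl.
  move=> s sT; rewrite (le_trans (HK2 s sT))// ler_wpM2r ?powR_ge0//.
  by rewrite (le_trans (ler_norm _))// lerDr.
have beta0 : 0 < beta by case: sigma1_H1 => /andP[].
have mu0 := hyp_H2_mu_gt0 b1_H2.
split.
  apply: (end_le (b1 ^~ z) (b2 ^~ z) mu mu0) => // s sT sT'.
  by have [] := main s z (lt0 s sT) sT'.
apply/eqP; rewrite eq_le; apply/andP; split.
  apply: (end_le (sigma1 ^~ z) (sigma2 ^~ z) beta) => // s sT sT'.
  by have [_ ->] := main s z (lt0 s sT) sT'.
apply: (end_le (sigma2 ^~ z) (sigma1 ^~ z) beta) => // s sT sT'.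
by have [_ ->] := main s z (lt0 s sT) sT'.
Qed.

End equations.

Theorem theorem3p10 (R : realType) (d : measure_display)
    (Omega : measurableType d) (P : probability Omega R)
    (P_complete : measure_is_complete P)
    (T H : R) (T_gt0 : 0 < T) (H_range : 2^-1 < H < 1)
    (B : R -> Omega -> R) (B_fBm : fBm P H B)
    (beta delta mu : R)
    (beta_gt : 1 - H < beta) (delta_gt : H^-1 - 1 < delta)
    (b1 b2 sigma1 sigma2 : R -> R -> R)
    (b1_cont : continuous_strip T b1) (b2_cont : continuous_strip T b2)
    (sigma1_cont : continuous_strip T sigma1)
    (sigma2_cont : continuous_strip T sigma2)
    (sigma1_H1 : hyp_H1 T beta delta sigma1)
    (b1_H2 : hyp_H2 T beta delta mu b1)
    (sigma2_H1 : hyp_H1 T beta delta sigma2)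
    (b2_H2 : hyp_H2 T beta delta mu b2)
    (X Y : R -> R -> R -> Omega -> R)
    (X_sol : forall t x : R, t \in `[0, T] ->
       is_solution P H T beta delta B b1 sigma1 t x (X t x))
    (Y_sol : forall t y : R, t \in `[0, T] ->
       is_solution P H T beta delta B b2 sigma2 t y (Y t y)) :
  (forall t x y : R, t \in `[0, T] -> x <= y ->
     \forall w \ae P, forall s : R, s \in `[t, T] -> X t x s w <= Y t y s w)
  <->
  (forall t z : R, t \in `[0, T] -> b1 t z <= b2 t z /\ sigma1 t z = sigma2 t z).
Proof.
split.
  exact: (comparison_necessary T_gt0 H_range B_fBm beta_gt delta_gt
    sigma1_H1 b1_H2 sigma2_H1 b2_H2 X_sol Y_sol).
exact: (comparison_sufficient H_range B_fBm beta_gt delta_gt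
  sigma1_H1 b1_H2 sigma2_H1 b2_H2 X_sol Y_sol).
Qed.
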